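(* Suppose that at each given $x_k$ the objective function $f$ and the constraint function $c$ are both twice continuously differentiable. Then the $k$th iteration of the Adaptive Augmented Lagrangian Line Search Algorithm (described in the context) is well posed. That is, either the algorithm terminates in Step 1 (returning a first-order stationary solution $(x_k,y_k)$) or in Step 2 (returning an infeasible stationary point $x_k$), or it computes $\mu_k>0$ such that $F_{\rm AL}(x_k,y_k,\mu_k)\neq 0$ and such that, for the steps $s_k=\overline s_k$ and $r_k=\overline r_k$ (the Cauchy steps), the conditions $$\Delta\tilde q(s_k;x_k,y_k,\mu_k)\ge \kappa_1\Delta\tilde q(\overline s_k;x_k,y_k,\mu_k)>0,\quad l\le x_k+s_k\le u,\quad \|s_k\|_2\le\Theta_k,$$ $$\Delta q_v(r_k;x_k)\ge\kappa_2\Delta q_v(\overline r_k;x_k)\ge 0,\quad l\le x_k+r_k\le u,\quad \|r_k\|_2\le\theta_k,$$ $$\Delta q_v(s_k;x_k)\ge\min\{\kappa_3\Delta q_v(r_k;x_k),\ v_k-\tfrac12(\kappa_t t_j)^2\}$$ are satisfied, in which case $(x_{k+1},y_{k+1},\mu_{k+1})$ will be computed.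
   Context: **Problem and notation.** The problem is: minimize $f(x)$ over $x\in\mathbb R^n$ subject to $c(x)=0$, $l\le x\le u$, where $f:\mathbb R^n\to\mathbb R$ and $c:\mathbb R^n\to\mathbb R^m$ are twice continuously differentiable and $l\le u$ in $\mathbb R^n$ (componentwise). Write $g=\nabla f$, $J(x)\in\mathbb R^{m\times n}$ for the Jacobian of $c$, $v(x)=\frac12\|c(x)\|_2^2$, and let $P$ be the componentwise projection onto the box $[l,u]$. Define - $\ell(x,y)=f(x)-c(x)^Ty$ and $\mathcal L(x,y,\mu)=\mu\,\ell(x,y)+v(x)$; - $F_{\rm L}(x,y)=P(x-\nabla_x\ell(x,y))-x$, $\ F_{\rm OPT}(x,y)=(F_{\rm L}(x,y),-c(x))$; - $F_{\rm FEAS}(x)=P(x-J(x)^Tc(x))-x$, $\ F_{\rm AL}(x,y,\mu)=P(x-\nabla_x\mathcal L(x,y,\mu))-x$; - $\pi(x,y,\mu)=y-\frac1\mu c(x)$. A subscript $k$ denotes evaluation at the iterate, e.g. $c_k=c(x_k)$, $J_k=J(x_k)$, $v_k=v(x_k)$. A pair $(x,y)$ with $l\le x\le u$ is first-order stationary for the problem if $F_{\rm OPT}(x,y)=0$; a point $x$ with $l\le x\le u$, $v(x)>0$, $F_{\rm FEAS}(x)=0$ is an infeasible stationary point. **Models.** $q_v(s;x)=\frac12\|c(x)+J(x)s\|_2^2$, and $$\tilde q(s;x,y,\mu)=\mathcal L(x,y,\mu)+\nabla_x\mathcal L(x,y,\mu)^Ts+\max\{\tfrac12 s^T(\mu\nabla^2_{xx}\ell(x,y)+J(x)^TJ(x))s,\,0\}.$$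 Put $\Delta q_v(s;x)=q_v(0;x)-q_v(s;x)$ and $\Delta\tilde q(s;x,y,\mu)=\tilde q(0;x,y,\mu)-\tilde q(s;x,y,\mu)$. **Routine CauchyFeas$(x_k,\theta_k)$** ($\theta_k\ge0$; constants $\varepsilon_r,\gamma\in(0,1)$). Compute the smallest integer $l_k\ge0$ with $\|P(x_k-\gamma^{l_k}J_k^Tc_k)-x_k\|_2\le\theta_k$. If $l_k>0$ set $\Gamma_k=\min\{2,\frac12(1+\|P(x_k-\gamma^{l_k-1}J_k^Tc_k)-x_k\|_2/\theta_k)\}$; otherwise set $\Gamma_k=2$. Set $\overline\beta_k=\gamma^{l_k}$, $\overline r_k=P(x_k-\overline\beta_kJ_k^Tc_k)-x_k$, $\varepsilon_k=0$. While it is not the case that both $\Delta q_v(\overline r_k;x_k)\ge-\varepsilon_r\overline r_k^TJ_k^Tc_k$ and $\|\overline r_k\|_2\le\theta_k$: set $\varepsilon_k\leftarrow\max(\varepsilon_k,-\Delta q_v(\overline r_k;x_k)/\overline r_k^TJ_k^Tc_k)$, then $\overline\beta_k\leftarrow\gamma\overline\beta_k$ and $\overline r_k\leftarrow P(x_k-\overline\beta_kJ_k^Tc_k)-x_k$. Return $(\overline\beta_k,\overline r_k,\varepsilon_k,\Gamma_k)$. **Routine CauchyAL$(x_k,y_k,\mu_k,\Theta_k,\varepsilon_k)$.** Set $\overline\alpha_k=1$, $\overline s_k=P(x_k-\overline\alpha_k\nabla_x\mathcal L(x_k,y_k,\mu_k))-x_k$. While it is not the case that both $\Delta\tilde q(\overline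 s_k;x_k,y_k,\mu_k)\ge-\frac{\varepsilon_k+\varepsilon_r}{2}\overline s_k^T\nabla_x\mathcal L(x_k,y_k,\mu_k)$ and $\|\overline s_k\|_2\le\Theta_k$: set $\overline\alpha_k\leftarrow\gamma\overline\alpha_k$ and recompute $\overline s_k$. Return $(\overline\alpha_k,\overline s_k)$. **Adaptive Augmented Lagrangian Line Search Algorithm.** Constants $\gamma,\gamma_\mu,\gamma_\alpha,\gamma_t,\gamma_T,\kappa_1,\kappa_2,\kappa_3,\varepsilon_r,\kappa_t,\eta_s\in(0,1)$ and $\delta,\epsilon,Y\in(0,\infty)$. Initial $(x_0,y_0)$ with $l\le x_0\le u$, and $\mu_0,t_0,t_1,T_1,Y_1\in(0,\infty)$ with $Y_1\ge Y$ and $\|y_0\|_2\le Y_1$; the values $Y_j$ generated below are such that $Y_{j+1}\ge Y_j$ for all $j$. Set $k=0$, $k_0=0$, $j=1$ and loop over: 1. If $F_{\rm OPT}(x_k,y_k)=0$, return the first-order stationary solution $(x_k,y_k)$. 2. If $\|c_k\|_2>0$ and $F_{\rm FEAS}(x_k)=0$, return the infeasible stationary point $x_k$. 3. While $F_{\rm AL}(x_k,y_k,\mu_k)=0$, set $\mu_k\leftarrow\gamma_\mu\mu_k$. 4. Set $\theta_k=\delta\|F_{\rm FEAS}(x_k)\|_2$ and $(\overline\beta_k,\overline r_k,\varepsilon_k,\Gamma_k)=$ CauchyFeas$(x_k,\theta_k)$. Set $\Theta_k=\Gamma_k\delta\|F_{\rm AL}(x_k,y_k,\mu_k)\|_2$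 and $(\overline\alpha_k,\overline s_k)=$ CauchyAL$(x_k,y_k,\mu_k,\Theta_k,\varepsilon_k)$. 5. Compute an approximate solution $r_k$ of $\min_r q_v(r;x_k)$ s.t. $l\le x_k+r\le u$, $\|r\|_2\le\theta_k$, and an approximate solution $s_k$ of $\min_s\tilde q(s;x_k,y_k,\mu_k)$ s.t. $l\le x_k+s\le u$, $\|s\|_2\le\Theta_k$, satisfying (A) $\Delta\tilde q(s_k;x_k,y_k,\mu_k)\ge\kappa_1\Delta\tilde q(\overline s_k;x_k,y_k,\mu_k)>0$, $l\le x_k+s_k\le u$, $\|s_k\|_2\le\Theta_k$; (B) $\Delta q_v(r_k;x_k)\ge\kappa_2\Delta q_v(\overline r_k;x_k)\ge0$, $l\le x_k+r_k\le u$, $\|r_k\|_2\le\theta_k$. 6. While (C) $\Delta q_v(s_k;x_k)\ge\min\{\kappa_3\Delta q_v(r_k;x_k),\,v_k-\frac12(\kappa_tt_j)^2\}$ is not satisfied or $F_{\rm AL}(x_k,y_k,\mu_k)=0$: set $\mu_k\leftarrow\gamma_\mu\mu_k$, redefine $\Theta_k=\Gamma_k\delta\|F_{\rm AL}(x_k,y_k,\mu_k)\|_2$, recompute $(\overline\alpha_k,\overline s_k)=$ CauchyAL$(x_k,y_k,\mu_k,\Theta_k,\varepsilon_k)$, and recompute an approximate solution $s_k$ satisfying (A). 7. Set $\alpha_k=\gamma_\alpha^{i}$ where $i\ge0$ is the smallest integer with $\mathcal L(x_k+\gamma_\alpha^{i}s_k,y_k,\mu_k)\le\mathcal L(x_k,y_k,\mu_k)-\eta_s\gamma_\alpha^{i}\Delta\tilde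 q(s_k;x_k,y_k,\mu_k)$. Set $x_{k+1}=x_k+\alpha_ks_k$. 8. If $\|c_{k+1}\|_2\le t_j$: compute any $\widehat y_{k+1}$ with $\|F_{\rm L}(x_{k+1},\widehat y_{k+1})\|_2\le\min\{\|F_{\rm L}(x_{k+1},y_k)\|_2,\|F_{\rm L}(x_{k+1},\pi(x_{k+1},y_k,\mu_k))\|_2\}$. If moreover $\min\{\|F_{\rm L}(x_{k+1},\widehat y_{k+1})\|_2,\|F_{\rm AL}(x_{k+1},y_k,\mu_k)\|_2\}\le T_j$, then set $k_j=k+1$, $Y_{j+1}=\max\{Y,t_{j-1}^{-\epsilon}\}$, $t_{j+1}=\min\{\gamma_tt_j,t_j^{1+\epsilon}\}$, $T_{j+1}=\gamma_TT_j$, $y_{k+1}=(1-\alpha_y)y_k+\alpha_y\widehat y_{k+1}$ where $\alpha_y$ is the largest value in $[0,1]$ with $\|(1-\alpha_y)y_k+\alpha_y\widehat y_{k+1}\|_2\le Y_{j+1}$, and $j\leftarrow j+1$. In all other cases set $y_{k+1}=y_k$. 9. Set $\mu_{k+1}=\mu_k$ and $k\leftarrow k+1$.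
   Formalization: In Step 6, when the reduced mu_k gives F_AL(x_k,y_k,mu_k)=0, condition (A) cannot hold since Theta_k=0; there the recomputed s_k is only required to be the (zero) Cauchy step, and the loop goes on to the next mu_k. *)

(* Defs.v *)
From mathcomp Require Import all_boot all_order all_algebra.
From mathcomp Require Import boolp classical_sets reals topology normedtype derive exp.

Set Implicit Arguments.
Unset Strict Implicit.
Unset Printing Implicit Defensive.

Import Order.TTheory GRing.Theory Num.Theory.
Import numFieldNormedType.Exports.

Local Open Scope classical_set_scope.
Local Open Scope ring_scope.

(* Vectors of R^n are rows 'rV[R]_n.  The library norm `|x| on rows is the
   sup norm, hence the separate Euclidean norm. *)
Section Vectors.
Context {R : realType} {n : nat}.
Implicit Types (a b x : 'rV[R]_n) (h : 'rV[R]_n -> R).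

Definition dotv a b : R := \sum_i a 0 i * b 0 i.

Definition enorm a : R := Num.sqrt (dotv a a).

Definition grad h x : 'rV[R]_n := \row_i 'D_(delta_mx 0 i) h x.

Definition hess h x : 'M[R]_n := 'J (grad h) x.

(* C^2 on a neighbourhood of x *)
Definition C2_at h x : Prop :=
  \forall z \near x,
    [/\ differentiable h z, differentiable (grad h) z
      & {for z, continuous (hess h)}].

End Vectors.

(* Big-step semantics of [while guard do body]: [while_loop guard body s s']
   holds iff some execution started in s terminates, in state s'. *)
Inductive while_loop (S : Type) (guard : S -> Prop) (body : S -> S -> Prop) :
    S -> S -> Prop :=
| while_exit s : ~ guard s -> while_loop guard body s s
| while_next s s1 s2 : guard s -> body s s1 ->
    while_loop guard body s1 s2 -> while_loop guard body s s2.

Definition least_nat (Q : nat -> Prop) (i : nat) : Prop :=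
  Q i /\ forall i' : nat, Q i' -> (i <= i')%N.

Record problem (R : realType) (n m : nat) := Problem {
  obj : 'rV[R]_n -> R;
  con : 'rV[R]_n -> 'rV[R]_m;
  lo : 'rV[R]_n;
  up : 'rV[R]_n;
  lo_le_up : forall i, lo 0 i <= up 0 i }.

Section Problem.
Context {R : realType} {n m : nat} (pb : problem R n m).
Implicit Types (x s : 'rV[R]_n) (y : 'rV[R]_m) (mu : R).

Let f := obj pb.
Let c := con pb.

Definition in_box x : Prop := forall i, lo pb 0 i <= x 0 i <= up pb 0 i.

Definition proj_box x : 'rV[R]_n :=
  \row_i Num.max (lo pb 0 i) (Num.min (x 0 i) (up pb 0 i)).

(* The library Jacobian 'J c x acts on rows by v *m 'J c x; its transpose is
   the usual m x n Jacobian, so that the row of J(x) s is s *m (Jcon x)^T and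
   the row of J(x)^T w is w *m Jcon x. *)
Definition Jcon x : 'M[R]_(m, n) := ('J c x)^T.

(* J(x)^T c(x) *)
Definition JTc x : 'rV[R]_n := c x *m Jcon x.

Definition viol x : R := 2^-1 * enorm (c x) ^+ 2.

Definition ell x y : R := f x - dotv (c x) y.

Definition AL x y mu : R := mu * ell x y + viol x.

Definition grad_ell x y : 'rV[R]_n := grad (fun z => ell z y) x.

Definition hess_ell x y : 'M[R]_n := hess (fun z => ell z y) x.

Definition grad_AL x y mu : 'rV[R]_n := grad (fun z => AL z y mu) x.

Definition F_L x y : 'rV[R]_n := proj_box (x - grad_ell x y) - x.

Definition F_OPT x y : 'rV[R]_(n + m) := row_mx (F_L x y) (- c x).

Definition F_FEAS x : 'rV[R]_n := proj_box (x - JTc x) - x.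

Definition F_AL x y mu : 'rV[R]_n := proj_box (x - grad_AL x y mu) - x.

Definition pi_mult x y mu : 'rV[R]_m := y - mu^-1 *: c x.

Definition first_order_stationary x y : Prop := in_box x /\ F_OPT x y = 0.

Definition infeasible_stationary x : Prop :=
  [/\ in_box x, 0 < viol x & F_FEAS x = 0].

Definition q_v s x : R := 2^-1 * enorm (c x + s *m (Jcon x)^T) ^+ 2.

Definition q_AL s x y mu : R :=
  AL x y mu + dotv (grad_AL x y mu) s
  + Num.max
      (2^-1 * (s *m (mu *: hess_ell x y + (Jcon x)^T *m Jcon x) *m s^T) 0 0) 0.

Definition dq_v s x : R := q_v 0 x - q_v s x.

Definition dq_AL s x y mu : R := q_AL 0 x y mu - q_AL s x y mu.

End Problem.

Record params (R : realType) := Params {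
  gamma : R; gamma_mu : R; gamma_alpha : R; gamma_t : R; gamma_T : R;
  kappa1 : R; kappa2 : R; kappa3 : R; eps_r : R; kappa_t : R; eta_s : R;
  delta : R; epsilon : R; Ymin : R;
  gamma01 : 0 < gamma < 1;
  gamma_mu01 : 0 < gamma_mu < 1;
  gamma_alpha01 : 0 < gamma_alpha < 1;
  gamma_t01 : 0 < gamma_t < 1;
  gamma_T01 : 0 < gamma_T < 1;
  kappa1_01 : 0 < kappa1 < 1;
  kappa2_01 : 0 < kappa2 < 1;
  kappa3_01 : 0 < kappa3 < 1;
  eps_r01 : 0 < eps_r < 1;
  kappa_t01 : 0 < kappa_t < 1;
  eta_s01 : 0 < eta_s < 1;
  delta_gt0 : 0 < delta;
  epsilon_gt0 : 0 < epsilon;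
  Ymin_gt0 : 0 < Ymin }.

Record initial (R : realType) (n m : nat) (pb : problem R n m) (pa : params R) :=
  Initial {
  x_init : 'rV[R]_n; y_init : 'rV[R]_m; mu_init : R;
  t_init0 : R; t_init1 : R; T_init1 : R; Y_init1 : R;
  x_init_box : in_box pb x_init;
  mu_init_gt0 : 0 < mu_init;
  t_init0_gt0 : 0 < t_init0;
  t_init1_gt0 : 0 < t_init1;
  T_init1_gt0 : 0 < T_init1;
  Y_init1_gt0 : 0 < Y_init1;
  Y_init1_ge : Ymin pa <= Y_init1;
  y_init_le : enorm y_init <= Y_init1 }.

(* Iterate (x_k, y_k, mu_k) at the start of iteration k, together with the
   current value of the counter j. *)
Record state (R : realType) (n m : nat) := State {
  st_x : 'rV[R]_n; st_y : 'rV[R]_m; st_mu : R; st_j : nat }.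

(* Output (beta, r, eps, Gamma) of CauchyFeas *)
Record feas_out (R : realType) (n : nat) := FeasOut {
  fo_beta : R; fo_r : 'rV[R]_n; fo_eps : R; fo_Gamma : R }.

(* Quantities revised along with mu_k: the radius Theta_k, the output
   (alpha, sbar) of CauchyAL and the step s_k *)
Record al_data (R : realType) (n : nat) := ALData {
  ad_mu : R; ad_Theta : R; ad_alpha : R; ad_sbar : 'rV[R]_n; ad_s : 'rV[R]_n }.

Section Algorithm.
Context {R : realType} {n m : nat}.
Variables (pb : problem R n m) (pa : params R) (ini : initial pb pa).
Implicit Types (x r s : 'rV[R]_n) (y : 'rV[R]_m) (mu theta Theta : R)
  (z : state R n m) (fo : feas_out R n) (w : al_data R n).

(* The values t_j (j >= 0), T_j and Y_j (j >= 1) depend on j only; T_0 and Y_0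
   are dummy values. *)
Fixpoint t_seq (j : nat) : R :=
  match j with
  | 0 => t_init0 ini
  | j'.+1 =>
      if j' is 0 then t_init1 ini
      else Num.min (gamma_t pa * t_seq j') (t_seq j' `^ (1 + epsilon pa))
  end.

Fixpoint T_seq (j : nat) : R :=
  match j with
  | 0 => T_init1 ini
  | j'.+1 => if j' is 0 then T_init1 ini else gamma_T pa * T_seq j'
  end.

Definition Y_seq (j : nat) : R :=
  if j is j'.+2 then Num.max (Ymin pa) (t_seq j' `^ (- epsilon pa))
  else Y_init1 ini.

Definition cond_s x y w : Prop :=
  [/\ dq_AL pb (ad_s w) x y (ad_mu w)
        >= kappa1 pa * dq_AL pb (ad_sbar w) x y (ad_mu w),
      kappa1 pa * dq_AL pb (ad_sbar w) x y (ad_mu w) > 0,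
      in_box pb (x + ad_s w) & enorm (ad_s w) <= ad_Theta w].

Definition cond_r x theta rbar r : Prop :=
  [/\ dq_v pb r x >= kappa2 pa * dq_v pb rbar x,
      kappa2 pa * dq_v pb rbar x >= 0,
      in_box pb (x + r) & enorm r <= theta].

Definition cond_infeas x (j : nat) r s : Prop :=
  dq_v pb s x >= Num.min (kappa3 pa * dq_v pb r x)
                         (viol pb x - 2^-1 * (kappa_t pa * t_seq j) ^+ 2).

Definition feas_step x (beta : R) : 'rV[R]_n :=
  proj_box pb (x - beta *: JTc pb x) - x.

Definition cauchy_feas x theta fo : Prop :=
  let guard (v : R * 'rV[R]_n * R) := let: (_, r, _) := v in
    ~ (dq_v pb r x >= - (eps_r pa * dotv r (JTc pb x)) /\ enorm r <= theta) in
  let body (v v' : R * 'rV[R]_n * R) := let: (beta, r, e) := v in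
    v' = (gamma pa * beta, feas_step x (gamma pa * beta),
          Num.max e (- (dq_v pb r x / dotv r (JTc pb x)))) in
  exists lk : nat,
  [/\ least_nat (fun i => enorm (feas_step x (gamma pa ^+ i)) <= theta) lk,
      fo_Gamma fo =
        (if lk is i.+1 then
           Num.min 2 (2^-1 * (1 + enorm (feas_step x (gamma pa ^+ i)) / theta))
         else 2)
    & while_loop guard body (gamma pa ^+ lk, feas_step x (gamma pa ^+ lk), 0)
        (fo_beta fo, fo_r fo, fo_eps fo)].

Definition al_step x y mu (alpha : R) : 'rV[R]_n :=
  proj_box pb (x - alpha *: grad_AL pb x y mu) - x.

Definition cauchy_AL x y mu Theta (eps alpha_out : R) (sbar_out : 'rV[R]_n) :
    Prop :=
  let guard (v : R * 'rV[R]_n) := let: (_, s) := v in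
    ~ (dq_AL pb s x y mu
         >= - ((eps + eps_r pa) / 2 * dotv s (grad_AL pb x y mu))
       /\ enorm s <= Theta) in
  let body (v v' : R * 'rV[R]_n) := let: (alpha, _) := v in
    v' = (gamma pa * alpha, al_step x y mu (gamma pa * alpha)) in
  while_loop guard body (1, al_step x y mu 1) (alpha_out, sbar_out).

Definition returns_step1 z : Prop := F_OPT pb (st_x z) (st_y z) = 0.

Definition returns_step2 z : Prop :=
  ~ returns_step1 z /\
  (0 < enorm (con pb (st_x z)) /\ F_FEAS pb (st_x z) = 0).

Definition step3 z mu : Prop :=
  while_loop (fun mu => F_AL pb (st_x z) (st_y z) mu = 0)
             (fun mu mu' => mu' = gamma_mu pa * mu) (st_mu z) mu.

Definition theta_of x : R := delta pa * enorm (F_FEAS pb x).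

Definition AL_setup z fo w : Prop :=
  ad_Theta w = fo_Gamma fo * delta pa
                 * enorm (F_AL pb (st_x z) (st_y z) (ad_mu w)) /\
  cauchy_AL (st_x z) (st_y z) (ad_mu w) (ad_Theta w) (fo_eps fo)
    (ad_alpha w) (ad_sbar w).

(* Which approximate solutions may be computed: [sel sbar s] says that s may be
   chosen when the Cauchy step is sbar. *)
Definition any_step (sbar s : 'rV[R]_n) : Prop := True.

Definition cauchy_step (sbar s : 'rV[R]_n) : Prop := s = sbar.

(* cond_s is unsatisfiable when F_AL = 0 at the reduced penalty parameter,
   since then Theta_k = 0.  The loop guard discards such a penalty parameter anyway,
   and in that case the Cauchy step (which is 0) is kept. *)
Definition step6 (sel : 'rV[R]_n -> 'rV[R]_n -> Prop) z fo r w w' : Prop :=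
  let x := st_x z in let y := st_y z in
  let guard w := ~ cond_infeas x (st_j z) r (ad_s w)
                 \/ F_AL pb x y (ad_mu w) = 0 in
  let body w w' :=
    [/\ ad_mu w' = gamma_mu pa * ad_mu w, AL_setup z fo w',
        sel (ad_sbar w') (ad_s w')
      & cond_s x y w'
        \/ (F_AL pb x y (ad_mu w') = 0 /\ ad_s w' = ad_sbar w')] in
  while_loop guard body w w'.

(* Steps 3 to 6: fo is the output of CauchyFeas, r the step r_k, and w holds
   the final mu_k, Theta_k, CauchyAL output and s_k. *)
Definition steps3_6 (sel : 'rV[R]_n -> 'rV[R]_n -> Prop) z fo r w : Prop :=
  exists w5 : al_data R n,
  [/\ step3 z (ad_mu w5),
      cauchy_feas (st_x z) (theta_of (st_x z)) fo /\ AL_setup z fo w5,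
      sel (fo_r fo) r /\ cond_r (st_x z) (theta_of (st_x z)) (fo_r fo) r,
      sel (ad_sbar w5) (ad_s w5) /\ cond_s (st_x z) (st_y z) w5
    & step6 sel z fo r w5 w].

Definition step7 z w x' : Prop :=
  let x := st_x z in let y := st_y z in
  exists2 i : nat,
    least_nat (fun i =>
      AL pb (x + gamma_alpha pa ^+ i *: ad_s w) y (ad_mu w)
      <= AL pb x y (ad_mu w)
         - eta_s pa * gamma_alpha pa ^+ i
           * dq_AL pb (ad_s w) x y (ad_mu w)) i
    & x' = x + gamma_alpha pa ^+ i *: ad_s w.

Definition yhat_ok x' y mu (yhat : 'rV[R]_m) : Prop :=
  enorm (F_L pb x' yhat)
  <= Num.min (enorm (F_L pb x' y)) (enorm (F_L pb x' (pi_mult pb x' y mu))).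

Definition is_alpha_y y (yhat : 'rV[R]_m) (Ynext a : R) : Prop :=
  let ok b := 0 <= b <= 1 /\ enorm ((1 - b) *: y + b *: yhat) <= Ynext in
  ok a /\ forall b, ok b -> b <= a.

(* Step 8 for a given choice of yhat (irrelevant if ||c_{k+1}|| > t_j),
   producing y_{k+1} and the next value of j *)
Definition step8 x' y mu (j : nat) (yhat y' : 'rV[R]_m) (j' : nat) : Prop :=
  let test := enorm (con pb x') <= t_seq j /\
    Num.min (enorm (F_L pb x' yhat)) (enorm (F_AL pb x' y mu)) <= T_seq j in
  (test /\ exists2 a : R, is_alpha_y y yhat (Y_seq j.+1) a
                        & y' = (1 - a) *: y + a *: yhat /\ j' = j.+1)
  \/ (~ test /\ (y' = y /\ j' = j)).

Definition steps7_9 z w z' : Prop :=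
  step7 z w (st_x z') /\
  (exists2 yhat : 'rV[R]_m,
     enorm (con pb (st_x z')) <= t_seq (st_j z) ->
       yhat_ok (st_x z') (st_y z) (ad_mu w) yhat
   & step8 (st_x z') (st_y z) (ad_mu w) (st_j z) yhat (st_y z') (st_j z'))
  /\ st_mu z' = ad_mu w.

Definition iteration z z' : Prop :=
  [/\ ~ returns_step1 z, ~ returns_step2 z
    & exists fo, exists r, exists w,
        steps3_6 any_step z fo r w /\ steps7_9 z w z'].

Definition init_state : state R n m :=
  State (x_init ini) (y_init ini) (mu_init ini) 1.

End Algorithm.

(* Main.v *)
Require Import Defs.
From mathcomp Require Import all_boot all_order all_algebra.
From mathcomp Require Import boolp classical_sets reals topology normedtype derive exp.
From mathcomp Require Import functions sequences realfun.
From mathcomp Require Import ring lra.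
Import Order.TTheory GRing.Theory Num.Theory.
Import numFieldNormedType.Exports.
Local Open Scope classical_set_scope.
Local Open Scope ring_scope.

Set Implicit Arguments.
Unset Strict Implicit.
Unset Printing Implicit Defensive.

(* Both models decrease by -<s, g> - max(s H s^T / 2, 0) for a suitable gradient
   g and matrix H, and the projected step s(a) = P(x - a g) - x satisfies
   ||s(a)||^2 <= -a <s(a), g>; hence for small a the quadratic term is dominated
   and both Cauchy routines stop, with a positive decrease unless s(1) = 0.
   As mu -> 0, grad L tends to J^T c, so F_AL -> F_FEAS: if F_AL = 0 for
   arbitrarily small mu then F_FEAS = 0, hence c = 0 (no return in Step 2), hence
   F_L = 0, contradicting Step 1.
   Step 6 stops for the following reason.  If c = 0, the second argument of the
   min is negative while s_k -> 0.  Otherwise F_FEAS <> 0, and because Gamma_k > 1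
   and eps_k < (eps_k + eps_r) / 2 < eps_r, every test of CauchyFeas is passed or
   failed strictly by the limit problem of CauchyAL; so for small mu both routines
   return the same power of gamma, s_k -> r_k, and kappa_3 < 1 gives (C).
   The line search succeeds since <s_k, grad L> <= -Delta q-tilde < 0, and the dual
   update is possible since ||y_k|| <= Y_j is invariant. *)

(** * Projected steps *)

Section Clamp.
Context {R : realType}.
Implicit Types l u t x d e : R.

Definition clamp l u t := Num.max l (Num.min t u).

Lemma clamp_bounds l u t : l <= u -> l <= clamp l u t <= u.
Proof. by rewrite /clamp => lu; rewrite le_max lexx ge_max lu ge_min lexx orbT. Qed.

Lemma le_clamp l u t t' : t <= t' -> clamp l u t <= clamp l u t'.
Proof.
move=> tt'; rewrite /clamp ge_max !le_max lexx /=; apply/orP; right.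
by rewrite le_min !ge_min lexx tt' !orbT.
Qed.

Lemma clamp_id l u x : l <= x <= u -> clamp l u x = x.
Proof. by case/andP=> lx xu; rewrite /clamp; move/min_idPl: xu => ->; apply/max_idPr. Qed.

(** Variational inequality of the projection onto [[l, u]]: with [p] the projection of [x + d],
    [(p - x) * (p - (x + d)) <= 0] because [x] lies in the interval. *)
Lemma clamp_sqr_le l u x d : l <= x <= u ->
  (clamp l u (x + d) - x) ^+ 2 <= d * (clamp l u (x + d) - x).
Proof.
case/andP=> lx xu; rewrite /clamp.
by case: (lerP (x + d) u) => ?; [case: (lerP l (x + d)) => ?|case: (lerP l u) => ?]; nra.
Qed.

Lemma clamp_sqr_mono l u x d a b : l <= x <= u -> 0 <= a -> a <= b ->
  (clamp l u (x + a * d) - x) ^+ 2 <= (clamp l u (x + b * d) - x) ^+ 2.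
Proof.
move=> xlu a0 ab; have := clamp_id xlu; case: (leP 0 d) => d0 xE.
  have adbd : x + a * d <= x + b * d by nra.
  have xad : x <= x + a * d by nra.
  have := le_clamp l u adbd; have := le_clamp l u xad; rewrite xE; nra.
have adbd : x + b * d <= x + a * d by nra.
have xad : x + a * d <= x by nra.
have := le_clamp l u adbd; have := le_clamp l u xad; rewrite xE; nra.
Qed.

(** A positive multiple of [d] leaves [x] fixed only if [d = 0] or [x] sits at the bound towards
    which [d] points, a condition independent of the multiple. *)
Lemma clamp_fix_scale l u x d a b : l <= x <= u -> 0 < a -> 0 <= b ->
  clamp l u (x + a * d) = x -> clamp l u (x + b * d) = x.
Proof.
move=> /andP[lx xu] a0 b0; rewrite /clamp.
have lu := le_trans lx xu.
case: (lerP (x + a * d) u) => ?; [case: (lerP l (x + a * d)) => ?|case: (lerP l u) => ?] => e;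
by (case: (lerP (x + b * d) u) => ?; [case: (lerP l (x + b * d)) => ?|case: (lerP l u) => ?]); nra.
Qed.

End Clamp.

(** * Euclidean inner product, norm and quadratic forms *)

Section Euclid.
Context {R : realType} {n : nat}.
Implicit Types a b s g : 'rV[R]_n.

Lemma dotvC a b : dotv a b = dotv b a.
Proof. by apply: eq_bigr => i _; rewrite mulrC. Qed.

Lemma dotv_ge0 a : 0 <= dotv a a.
Proof. by apply: sumr_ge0 => i _; rewrite -expr2 sqr_ge0. Qed.

Lemma dotv0l a : dotv 0 a = 0.
Proof. by apply: big1 => i _; rewrite mxE mul0r. Qed.

Lemma dotvDl a b g : dotv (a + b) g = dotv a g + dotv b g.
Proof. by rewrite -big_split; apply: eq_bigr => i _; rewrite mxE mulrDl. Qed.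

Lemma dotvE a b : dotv a b = (a *m b^T) 0 0.
Proof. by rewrite mxE; apply: eq_bigr => i _; rewrite mxE. Qed.

Lemma sqr_le_dotv a i : a 0 i ^+ 2 <= dotv a a.
Proof.
rewrite /dotv (bigD1 i) //= -expr2 lerDl.
by apply: sumr_ge0 => j _; rewrite -expr2 sqr_ge0.
Qed.

Lemma dotv_eq0 a : (dotv a a == 0) = (a == 0).
Proof.
apply/eqP/eqP => [a0|->]; last exact: dotv0l.
apply/rowP => i; rewrite mxE; apply/eqP; rewrite -sqrf_eq0 eq_le sqr_ge0 andbT.
by rewrite -a0 sqr_le_dotv.
Qed.

Lemma dotv_gt0 a : (0 < dotv a a) = (a != 0).
Proof. by rewrite lt_def dotv_ge0 andbT dotv_eq0. Qed.

Lemma enorm_ge0 a : 0 <= enorm a. Proof. exact: sqrtr_ge0. Qed.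

Lemma enorm_sqr a : enorm a ^+ 2 = dotv a a.
Proof. by rewrite sqr_sqrtr ?dotv_ge0. Qed.

Lemma enorm_eq0 a : (enorm a == 0) = (a == 0).
Proof. by rewrite -sqrf_eq0 enorm_sqr dotv_eq0. Qed.

Lemma enorm_gt0 a : (0 < enorm a) = (a != 0).
Proof. by rewrite lt_def enorm_ge0 andbT enorm_eq0. Qed.

Lemma enorm0 : enorm (0 : 'rV[R]_n) = 0.
Proof. by apply/eqP; rewrite enorm_eq0. Qed.

Lemma ler_enorm a b : (enorm a <= enorm b) = (dotv a a <= dotv b b).
Proof. by rewrite ler_sqrt ?dotv_ge0. Qed.

(** Since [|s_i s_j| <= dotv s s], the sum of the absolute values of the entries of [H] serves as
    [K]. *)
Lemma quad_form_le (H : 'M[R]_n) : exists2 K : R, 0 <= K &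
  forall s, (s *m H *m s^T) 0 0 <= K * dotv s s.
Proof.
exists (\sum_j \sum_i `|H i j|); first by do 2!apply: sumr_ge0 => ? _.
move=> s; rewrite mxE mulr_suml; apply: ler_sum => j _.
rewrite !mxE !mulr_suml; apply: ler_sum => i _.
have si := sqr_le_dotv s i; have sj := sqr_le_dotv s j.
have hij : `|s 0 i * s 0 j| <= dotv s s by rewrite ler_norml; apply/andP; split; nra.
rewrite mulrAC (le_trans (ler_norm _)) // normrM mulrC.
by apply: ler_wpM2l.
Qed.

End Euclid.

(* The common form of both model reductions: with g = J^T c and H = J^T J it is
   Delta q_v, with g = mu grad ell + J^T c and H = mu hess ell + J^T J it is
   Delta q-tilde. *)
Definition model_dec {R : realType} {n : nat} (g : 'rV[R]_n) (H : 'M[R]_n)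
    (s : 'rV[R]_n) : R :=
  - dotv s g - Num.max (2^-1 * (s *m H *m s^T) 0 0) 0.

Section ProjStep.
Context {R : realType} {n m : nat} (pb : problem R n m).
Variables (x : 'rV[R]_n) (xbox : in_box pb x).
Implicit Types (g s : 'rV[R]_n) (a b : R).

Definition proj_step g a : 'rV[R]_n := proj_box pb (x - a *: g) - x.

Lemma proj_stepE g a i :
  proj_step g a 0 i = clamp (lo pb 0 i) (up pb 0 i) (x 0 i + a * - g 0 i) - x 0 i.
Proof. by rewrite !mxE mulrN. Qed.

Lemma proj_box_in t : in_box pb (proj_box pb t).
Proof. by move=> i; rewrite mxE; apply/clamp_bounds/lo_le_up. Qed.

Lemma proj_step_in g a : in_box pb (x + proj_step g a).
Proof. by rewrite /proj_step addrC subrK; exact: proj_box_in. Qed.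

Lemma proj_step_eq0P g a :
  proj_step g a = 0 <->
  forall i, clamp (lo pb 0 i) (up pb 0 i) (x 0 i + a * - g 0 i) = x 0 i.
Proof.
split=> [/rowP s0 i|s0]; first by apply/subr0_eq; rewrite -proj_stepE s0 mxE.
by apply/rowP => i; rewrite proj_stepE s0 subrr mxE.
Qed.

Lemma proj_step_g0 a : proj_step 0 a = 0.
Proof.
apply/proj_step_eq0P => i.
by rewrite mxE oppr0 mulr0 addr0; apply/clamp_id/xbox.
Qed.

Lemma proj_step_dot g a :
  dotv (proj_step g a) (proj_step g a) <= a * - dotv (proj_step g a) g.
Proof.
rewrite -sumrN mulr_sumr; apply: ler_sum => i _.
rewrite proj_stepE -expr2 (le_trans (clamp_sqr_le _ (xbox i))) //.
by rewrite le_eqVlt; apply/orP; left; apply/eqP; ring.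
Qed.

Lemma proj_step_dot_le g a : 0 <= a ->
  dotv (proj_step g a) (proj_step g a) <= a ^+ 2 * dotv g g.
Proof.
move=> a0; rewrite mulr_sumr; apply: ler_sum => i _.
rewrite proj_stepE -!expr2 -exprMn.
have := clamp_sqr_le (a * - g 0 i) (xbox i); move: (clamp _ _ _ - _) => d.
by set w := g 0 i; have := sqr_ge0 (d + a * w); nra.
Qed.

Lemma le_enorm_proj_step g a b : 0 <= a -> a <= b ->
  enorm (proj_step g a) <= enorm (proj_step g b).
Proof.
move=> a0 ab; rewrite ler_enorm; apply: ler_sum => i _.
by rewrite !proj_stepE -!expr2; apply: clamp_sqr_mono (xbox i) a0 ab.
Qed.

(** Lets the steps of length 1, that is [F_AL] and [F_FEAS], decide whether a backtracked step
    vanishes. *)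
Lemma proj_step_eq0 g a b : 0 < a -> 0 <= b ->
  proj_step g a = 0 -> proj_step g b = 0.
Proof.
move=> a0 b0 /proj_step_eq0P s0; apply/proj_step_eq0P => i.
exact: clamp_fix_scale (xbox i) a0 b0 (s0 i).
Qed.

Lemma proj_step_scale g a b : proj_step (a *: g) b = proj_step g (b * a).
Proof. by rewrite /proj_step scalerA. Qed.

Lemma proj_step_descent g a : 0 < a -> proj_step g 1 != 0 ->
  0 < - dotv (proj_step g a) g.
Proof.
move=> a0 g1; have : proj_step g a != 0.
  by apply: contra_neq g1; apply: proj_step_eq0 => //; rewrite ler01.
by rewrite -dotv_gt0 => /lt_le_trans/(_ (proj_step_dot g a)); rewrite pmulr_rgt0.
Qed.

End ProjStep.

(** * The models and their gradients *)

Section Models.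
Context {R : realType} {n m : nat} (pb : problem R n m) (x : 'rV[R]_n).
Implicit Types (s : 'rV[R]_n) (y : 'rV[R]_m) (mu : R).

Definition gram : 'M[R]_n := (Jcon pb x)^T *m Jcon pb x.

Lemma gram_formE s :
  (s *m gram *m s^T) 0 0 = dotv (s *m (Jcon pb x)^T) (s *m (Jcon pb x)^T).
Proof. by rewrite dotvE /gram trmx_mul trmxK !mulmxA. Qed.

Lemma model_dec0 (g : 'rV[R]_n) H : model_dec g H 0 = 0.
Proof. by rewrite /model_dec dotv0l !mul0mx mxE mulr0 maxxx oppr0 addr0. Qed.

(** [gram] is positive semidefinite, so the maximum in [model_dec] is the quadratic term itself. *)
Lemma dq_vE s : dq_v pb s x = model_dec (JTc pb x) gram s.
Proof.
rewrite /dq_v /q_v /model_dec gram_formE max_l; last first.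
  by rewrite mulr_ge0 ?dotv_ge0 ?invr_ge0.
rewrite !enorm_sqr mul0mx addr0.
have -> : dotv s (JTc pb x) = dotv (s *m (Jcon pb x)^T) (con pb x).
  by rewrite !dotvE /JTc trmx_mul mulmxA.
rewrite dotvDl ![dotv _ (con pb x + _)]dotvC !dotvDl.
rewrite [dotv (con pb x) (s *m _)]dotvC; lra.
Qed.

Lemma dq_ALE s y mu : dq_AL pb s x y mu =
  model_dec (grad_AL pb x y mu) (mu *: hess_ell pb x y + gram) s.
Proof.
rewrite /dq_AL /q_AL /model_dec -/gram [dotv _ 0]dotvC dotv0l !mul0mx mxE mulr0.
by rewrite maxxx [dotv _ s]dotvC; ring.
Qed.

End Models.

(** * Differentiability and gradients of the violation and of the augmented Lagrangian *)

Section Gradients.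
Context {R : realType} {n m : nat} (pb : problem R n m) (x : 'rV[R]_n).
Implicit Types (y : 'rV[R]_m) (s : 'rV[R]_n) (mu : R).
Hypothesis f_diff : differentiable (obj pb) x.
Hypothesis c_diff : forall a, differentiable (fun z => con pb z 0 a) x.

Let ellE y : (fun z => ell pb z y) =
  obj pb - \sum_a (y 0 a \*: (fun z => con pb z 0 a)).
Proof.
apply/funext => z; rewrite /ell -[RHS]/(_ z - (\sum_a _) z) fct_sumE.
by congr (_ - _); apply: eq_bigr => a _; rewrite mulrC.
Qed.

Let violE : viol pb =
  2^-1 \*: \sum_a ((fun z => con pb z 0 a) * (fun z => con pb z 0 a)).
Proof.
apply/funext => z; by rewrite /viol enorm_sqr -[RHS]/(_ * (\sum_a _) z) fct_sumE.
Qed.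

Let ALE y mu : (fun z => AL pb z y mu) = mu \*: (fun z => ell pb z y) + viol pb.
Proof. by []. Qed.

Lemma differentiable_ell y : differentiable (fun z => ell pb z y) x.
Proof.
rewrite ellE; apply: differentiableB => //; apply: differentiable_sum => a.
exact: differentiableZ.
Qed.

Lemma differentiable_viol : differentiable (viol pb) x.
Proof.
rewrite violE; apply: differentiableZ; apply: differentiable_sum => a.
exact: differentiableM.
Qed.

Lemma differentiable_AL y mu : differentiable (fun z => AL pb z y mu) x.
Proof.
rewrite ALE; apply: differentiableD; last exact: differentiable_viol.
exact/differentiableZ/differentiable_ell.
Qed.

Lemma differentiable_con : differentiable (con pb) x.
Proof.
(* Differentiability is assumed for each component, so [con pb] is reassembled from them along the
   unit rows. *)
have -> : con pb = \sum_a (fun z => con pb z 0 a *: delta_mx 0 a).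
  by apply/funext => z; rewrite fct_sumE {1}[con pb z]row_sum_delta.
by apply: differentiable_sum => a; apply: differentiableZl.
Qed.

Lemma grad_viol : grad (viol pb) x = JTc pb x.
Proof.
apply/rowP => i; rewrite !mxE violE deriveZ; last first.
  by apply: derivable_sum => a; apply: derivableM; apply: diff_derivable.
rewrite derive_sum; last by move=> a; apply: derivableM; apply: diff_derivable.
rewrite scaler_sumr; apply: eq_bigr => a _.
rewrite deriveM; try exact: diff_derivable.
have -> : Jcon pb x a i = 'D_(delta_mx 0 i) (fun z => con pb z 0 a) x.
  rewrite mxE; transitivity (('D_(delta_mx 0 i) (con pb) x) 0 a).
    rewrite (deriveEjacobian _ differentiable_con) -rowE [RHS]mxE. reflexivity.
  by rewrite derive_mx ?mxE//; apply/diff_derivable/differentiable_con.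
rewrite /GRing.scale /=; lra.
Qed.

Lemma grad_ALE y mu :
  grad_AL pb x y mu = mu *: grad_ell pb x y + JTc pb x.
Proof.
rewrite -grad_viol; apply/rowP => i; rewrite !mxE ALE deriveD.
- by rewrite deriveZ //; apply/diff_derivable/differentiable_ell.
- by apply/derivableZ/diff_derivable/differentiable_ell.
- exact/diff_derivable/differentiable_viol.
Qed.

Lemma derive_AL y mu s : 'D_s (fun z => AL pb z y mu) x = dotv s (grad_AL pb x y mu).
Proof.
have dAL := differentiable_AL y mu.
rewrite deriveE // [in LHS](row_sum_delta s) linear_sum.
by apply: eq_bigr => i _; rewrite linearZ mxE deriveE.
Qed.

End Gradients.

(** * Backtracking and limits *)

Lemma least_nat_exists (Q : nat -> Prop) : (exists i, Q i) -> exists i, least_nat Q i.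
Proof.
case=> i0 Qi0; have ex : exists i, `[< Q i >] by exists i0; apply/asboolP.
case: (ex_minnP ex) => i /asboolP Qi imin; exists i; split=> // i' /asboolP.
exact: imin.
Qed.

Section WhileLoop.
Context {S : Type}.
Implicit Types (guard : S -> Prop) (body : S -> S -> Prop).

(** Reduces termination of a backtracking loop to the existence of a first index at which the guard
    fails along the trajectory [v]. *)
Lemma while_least guard body (v : nat -> S) i :
  (forall i, guard (v i) -> body (v i) (v i.+1)) ->
  least_nat (fun i => ~ guard (v i)) i -> while_loop guard body (v 0) (v i).
Proof.
elim: i v => [|i IH] v bodyv [Ngi imin]; first exact: while_exit.
have gv0 : guard (v 0) by apply: contrapT => /imin.
apply: (while_next gv0); first exact: bodyv.
apply: (IH (fun i => v i.+1)) => [i'|]; first exact: bodyv.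
by split=> // i' /imin.
Qed.

Lemma while_inv guard body (P : S -> Prop) s s' :
  (forall s s', guard s -> P s -> body s s' -> P s') ->
  while_loop guard body s s' -> P s -> P s' /\ ~ guard s'.
Proof.
move=> step; elim=> {s s'} [s Ng Ps|s s1 s2 gs bs _ IH Ps]; first by split.
exact/IH/(step _ _ gs).
Qed.

Lemma while_sub guard body body' s s' :
  (forall s s', body s s' -> body' s s') ->
  while_loop guard body s s' -> while_loop guard body' s s'.
Proof.
move=> bb'; elim=> {s s'} [s Ng|s s1 s2 gs bs _]; first exact: while_exit.
by apply: while_next => //; apply: bb'.
Qed.

End WhileLoop.

Lemma near_expr_lt {R : realType} (q K e : R) : 0 < q < 1 -> 0 < e ->
  \forall i \near \oo, q ^+ i * K < e.
Proof.
case/andP=> q0 q1 e0; have : (fun i => q ^+ i * K) @ \oo --> (0 : R).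
  rewrite -[0](mul0r K); apply: cvgMr_tmp.
  by have := @cvg_expr R q; apply; rewrite ger0_norm ?ltW.
by move/cvgr_lt; apply.
Qed.

(** * Limits of steps and models, entry by entry *)

Section EntrywiseLimits.
Context {R : realType} {T : Type} (F : set_system T) {FF : Filter F}.

(** Stated on entries, so that matrix products, clamps and norms reduce to limits of real
    functions. *)
Definition mx_cvg {p q} (f : T -> 'M[R]_(p, q)) (a : 'M[R]_(p, q)) : Prop :=
  forall i j, (fun t => f t i j) @ F --> a i j.

Lemma mx_cvg_cst p q (a : 'M[R]_(p, q)) : mx_cvg (fun=> a) a.
Proof. by move=> i j; apply: cvg_cst. Qed.

Lemma mx_cvgD p q f g (a b : 'M[R]_(p, q)) : mx_cvg f a -> mx_cvg g b ->
  mx_cvg (fun t => f t + g t) (a + b).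
Proof.
move=> fa gb i j; rewrite mxE; under eq_fun do rewrite mxE.
exact: cvgD (fa i j) (gb i j).
Qed.

Lemma mx_cvgZl p q (k : T -> R) (l : R) (a : 'M[R]_(p, q)) : k @ F --> l ->
  mx_cvg (fun t => k t *: a) (l *: a).
Proof.
move=> kl i j; rewrite mxE; under eq_fun do rewrite mxE.
exact: cvgMr_tmp.
Qed.

Lemma mx_cvgM p q r f g (a : 'M[R]_(p, q)) (b : 'M[R]_(q, r)) :
  mx_cvg f a -> mx_cvg g b -> mx_cvg (fun t => f t *m g t) (a *m b).
Proof.
move=> fa gb i j; rewrite mxE; under eq_fun do rewrite mxE.
apply: cvg_big => [|k _]; first exact: add_continuous.
exact: cvgM (fa i k) (gb k j).
Qed.

Lemma mx_cvg_tr p q f (a : 'M[R]_(p, q)) : mx_cvg f a ->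
  mx_cvg (fun t => (f t)^T) a^T.
Proof. by move=> fa i j; rewrite mxE; under eq_fun do rewrite mxE; exact: fa. Qed.

Lemma cvg_maxr (f g : T -> R) (a b : R) : f @ F --> a -> g @ F --> b ->
  (fun t => Num.max (f t) (g t)) @ F --> Num.max a b.
Proof.
move=> fa gb; rewrite maxr_absE; under eq_fun do rewrite maxr_absE.
by apply: cvgMr_tmp; apply: cvgD; [exact: cvgD|apply: cvg_norm; exact: cvgB].
Qed.

Lemma cvg_minr (f g : T -> R) (a b : R) : f @ F --> a -> g @ F --> b ->
  (fun t => Num.min (f t) (g t)) @ F --> Num.min a b.
Proof.
move=> fa gb; rewrite minr_absE; under eq_fun do rewrite minr_absE.
by apply: cvgMr_tmp; apply: cvgB; [exact: cvgD|apply: cvg_norm; exact: cvgB].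
Qed.

Lemma cvg_dotv p (f g : T -> 'rV[R]_p) a b : mx_cvg f a -> mx_cvg g b ->
  (fun t => dotv (f t) (g t)) @ F --> dotv a b.
Proof.
move=> fa gb; rewrite dotvE; under eq_fun do rewrite dotvE.
exact: mx_cvgM fa (mx_cvg_tr gb) 0 0.
Qed.

Lemma cvg_enorm p (f : T -> 'rV[R]_p) a : mx_cvg f a ->
  (fun t => enorm (f t)) @ F --> enorm a.
Proof.
move=> fa; apply: (continuous_cvg _ (@sqrt_continuous R (dotv a a))).
exact: cvg_dotv.
Qed.

Lemma cvg_model_dec p (g : T -> 'rV[R]_p) H s g0 H0 s0 :
  mx_cvg g g0 -> mx_cvg H H0 -> mx_cvg s s0 ->
  (fun t => model_dec (g t) (H t) (s t)) @ F --> model_dec g0 H0 s0.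
Proof.
move=> gg HH ss; apply: cvgB; first by apply: cvgN; apply: cvg_dotv.
apply: cvg_maxr; last exact: cvg_cst.
by apply: cvgMl_tmp; apply: (mx_cvgM (mx_cvgM ss HH) (mx_cvg_tr ss)).
Qed.

Lemma mx_cvg_proj_step n m (pb : problem R n m) x g g0 a : mx_cvg g g0 ->
  mx_cvg (fun t => proj_step pb x (g t) a) (proj_step pb x g0 a).
Proof.
move=> gg i j; rewrite ord1 proj_stepE; under eq_fun do rewrite proj_stepE.
apply: cvgB; last exact: cvg_cst.
apply: cvg_maxr; first exact: cvg_cst.
apply: cvg_minr; last exact: cvg_cst.
apply: cvgD; first exact: cvg_cst.
by apply: cvgMl_tmp; apply: cvgN; apply: gg.
Qed.

End EntrywiseLimits.

(** * Acceptance of short projected steps *)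

Section Backtracking.
Context {R : realType} {n m : nat} (pb : problem R n m) (pa : params R).
Variables (x : 'rV[R]_n) (xbox : in_box pb x).
Implicit Types (g : 'rV[R]_n) (H : 'M[R]_n) (e Theta : R).

Definition btr_step g (i : nat) : 'rV[R]_n := proj_step pb x g (gamma pa ^+ i).

(** The common test of both Cauchy routines: [e] is [eps_r] in CauchyFeas and the mean of [eps_k]
    and [eps_r] in CauchyAL. *)
Definition accepts e Theta g H (i : nat) : Prop :=
  - (e * dotv (btr_step g i) g) <= model_dec g H (btr_step g i) /\
  enorm (btr_step g i) <= Theta.

Lemma gamma_expr_gt0 i : 0 < gamma pa ^+ i.
Proof. by case/andP: (gamma01 pa) => *; rewrite exprn_gt0. Qed.

Lemma gamma_expr_le1 i : gamma pa ^+ i <= 1.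
Proof. by case/andP: (gamma01 pa) => /ltW ? /ltW ?; rewrite exprn_ile1. Qed.

(** With step length [q] the quadratic term is at most [K * dotv s s <= q * K * - dotv s g], which
    for small [q] fits into the share [1 - e] of the linear decrease that the test leaves over. *)
Lemma accepts_near e Theta g H : e < 1 -> 0 < Theta ->
  \forall i \near \oo, accepts e Theta g H i.
Proof.
move=> e1 Th0; have [K K0 HK] := quad_form_le H.
have e10 : 0 < 1 - e by rewrite subr_gt0.
near=> i; have q0 := gamma_expr_gt0 i; have q1 := gamma_expr_le1 i.
have Kq : gamma pa ^+ i * K < 1 - e by near: i; apply: near_expr_lt (gamma01 pa) _.
(* The squared step norm is at most [q ^+ 2 * dotv g g]; the first power of [q] suffices here since
   [q <= 1]. *)
have gq : gamma pa ^+ i * dotv g g < Theta ^+ 2.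
  by near: i; apply: near_expr_lt (gamma01 pa) _; rewrite exprn_gt0.
have ss := proj_step_dot xbox g (gamma pa ^+ i).
have ssg := proj_step_dot_le xbox g (ltW q0).
rewrite /accepts -/(btr_step g i) in ss ssg *.
set q := gamma pa ^+ i in q0 q1 Kq gq ss ssg; set s := btr_step g i in ss ssg *.
have ss0 := dotv_ge0 s; have gg0 := dotv_ge0 g.
have sg0 : 0 <= - dotv s g by rewrite -(pmulr_rge0 _ q0) (le_trans ss0).
split.
  rewrite /model_dec; have := HK s; move: ((s *m H *m s^T) 0 0) => h hK.
  have hle : Num.max (2^-1 * h) 0 <= (1 - e) * - dotv s g.
    rewrite ge_max; apply/andP; split; last by rewrite mulr_ge0 // ltW.
    have Kss : K * dotv s s <= (1 - e) * - dotv s g.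
      rewrite (le_trans (ler_wpM2l K0 ss))// mulrCA mulrA.
      exact: ler_wpM2r sg0 _ _ (ltW Kq).
    have : 0 <= K * dotv s s by rewrite mulr_ge0.
    lra.
  lra.
rewrite -(ler_pXn2r (n := 2)) ?nnegrE ?enorm_ge0 ?(ltW Th0) //.
rewrite enorm_sqr (le_trans ssg)// (le_trans _ (ltW gq))// ler_wpM2r//.
by rewrite expr2 ger_pMr.
Unshelve. all: end_near. Qed.

End Backtracking.

(** * The Cauchy routines *)

Lemma F_FEASE {R : realType} {n m : nat} (pb : problem R n m) x :
  F_FEAS pb x = proj_step pb x (JTc pb x) 1.
Proof. by rewrite /F_FEAS /proj_step scale1r. Qed.

Lemma F_ALE {R : realType} {n m : nat} (pb : problem R n m) x y mu :
  F_AL pb x y mu = proj_step pb x (grad_AL pb x y mu) 1.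
Proof. by rewrite /F_AL /proj_step scale1r. Qed.

Lemma F_LE {R : realType} {n m : nat} (pb : problem R n m) x y :
  F_L pb x y = proj_step pb x (grad_ell pb x y) 1.
Proof. by rewrite /F_L /proj_step scale1r. Qed.

Section Routines.
Context {R : realType} {n m : nat} (pb : problem R n m) (pa : params R).
Variables (x : 'rV[R]_n) (xbox : in_box pb x).
Implicit Types (y : 'rV[R]_m) (mu Theta eps : R).

Lemma cauchy_AL_least y mu Theta eps i :
  least_nat (accepts pb pa x ((eps + eps_r pa) / 2) Theta (grad_AL pb x y mu)
               (mu *: hess_ell pb x y + gram pb x)) i ->
  cauchy_AL pb pa x y mu Theta eps (gamma pa ^+ i)
    (btr_step pb pa x (grad_AL pb x y mu) i).
Proof.
case=> acci imin; rewrite /cauchy_AL.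
set v := fun i => (gamma pa ^+ i, btr_step pb pa x (grad_AL pb x y mu) i).
have -> : (1, al_step pb x y mu 1) = v 0 by rewrite /v /btr_step expr0.
rewrite -[(_, _) in X in while_loop _ _ _ X]/(v i).
apply: while_least => [i' _|]; first by rewrite /v /btr_step exprS.
split=> [|i']; rewrite /v dq_ALE; first by move=> /(_ acci).
by move=> /contrapT acci'; apply: imin.
Qed.

(** The value of [eps_k] after [k] passes of the CauchyFeas loop whose successive ratios are [u]. *)
Fixpoint running_max (u : nat -> R) (k : nat) : R :=
  if k is k'.+1 then Num.max (running_max u k') (u k') else 0.

Lemma running_max_ge0 u k : 0 <= running_max u k.
Proof. by elim: k => //= k IH; rewrite le_max IH. Qed.

Lemma running_max_ge u k i : (i < k)%N -> u i <= running_max u k.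
Proof.
elim: k => //= k IH; rewrite ltnS leq_eqVlt le_max => /orP[/eqP->|/IH->//].
by rewrite lexx orbT.
Qed.

Lemma running_max_lt u k e : 0 < e -> (forall i, (i < k)%N -> u i < e) ->
  running_max u k < e.
Proof.
move=> e0; elim: k => //= k IH ue; rewrite gt_max ue// andbT.
by apply: IH => i ik; apply/ue/ltnW.
Qed.

Let g := JTc pb x.
Let H := gram pb x.
Let theta := theta_of pb pa x.
Let r i := btr_step pb pa x g i.

Lemma enorm_btr_step_anti (h : 'rV[R]_n) i i' : (i <= i')%N ->
  enorm (btr_step pb pa x h i') <= enorm (btr_step pb pa x h i).
Proof.
move=> ii'; apply: le_enorm_proj_step => //; first exact/ltW/gamma_expr_gt0.
case/andP: (gamma01 pa) => *; apply: ler_wiXn2l => //; exact: ltW.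
Qed.

(* The slack between Gamma_k > 1 and 1, and between (eps_k + eps_r) / 2 and
   both eps_k and eps_r, makes every test of CauchyFeas strict for the
   parameters with which CauchyAL is called. *)
Lemma cauchy_feas_spec : F_FEAS pb x != 0 ->
  exists (ib : nat) (eps Gamma : R),
  [/\ cauchy_feas pb pa x theta (FeasOut (gamma pa ^+ ib) (r ib) eps Gamma),
      accepts pb pa x (eps_r pa) theta g H ib,
      0 <= eps < eps_r pa,
      1 < Gamma
    & forall i, (i < ib)%N -> Gamma * theta < enorm (r i) \/
        model_dec g H (r i) < - ((eps + eps_r pa) / 2 * dotv (r i) g)].
Proof.
move=> F0; have th0 : 0 < theta by rewrite mulr_gt0 ?delta_gt0 ?enorm_gt0.
have /andP[er0 er1] := eps_r01 pa.
have D0 i : 0 < - dotv (r i) g.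
  by apply: (proj_step_descent xbox); rewrite ?gamma_expr_gt0 // -F_FEASE.
have near_acc := accepts_near pa xbox g H er1 th0.
have [i0 [_ ni0]] := filter_ex near_acc.
have [lk [nlk lkmin]] : exists lk, least_nat (fun i => enorm (r i) <= theta) lk.
  by apply: least_nat_exists; exists i0.
have [i1 [lki1 acci1]] := filter_ex (filterI (nbhs_infty_ge lk) near_acc).
(* The loop starts from the exponent [lk] of the radius search; [N] is its number of passes. *)
have [N [accN Nmin]] :
    exists N, least_nat (fun N => accepts pb pa x (eps_r pa) theta g H (lk + N)) N.
  by apply: least_nat_exists; exists (i1 - lk)%N; rewrite subnKC.
pose ratio i := - (dq_v pb (r (lk + i)) x / dotv (r (lk + i)) g).
have ratioE i : model_dec g H (r (lk + i)) = ratio i * - dotv (r (lk + i)) g.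
  by rewrite mulrNN dq_vE divfK // -oppr_eq0 gt_eqF.
(* From [lk] on the radius test holds, as step norms do not increase; a rejection therefore means
   that the decrease test failed. *)
have ratio_lt i : (i < N)%N -> ratio i < eps_r pa.
  move=> iN; rewrite ltNge; apply/negP => ri.
  have : (N <= i)%N; last by rewrite leqNgt iN.
  apply: Nmin; split; last first.
    by rewrite (le_trans _ nlk)//; apply: enorm_btr_step_anti; rewrite leq_addr.
  by rewrite -/(r (lk + i)) ratioE -mulrN; apply: ler_wpM2r ri; apply: ltW.
pose Gamma := if lk is i.+1 then Num.min 2 (2^-1 * (1 + enorm (r i) / theta)) else 2.
(* By minimality of [lk] the preceding step is longer than [theta], so the mean of 1 and its
   relative length exceeds 1. *)
have Gamma1 : 1 < Gamma.
  rewrite /Gamma; case: (lk) lkmin => [|l] lmin; first by rewrite ltr1n.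
  rewrite lt_min ltr1n /= mulrC ltr_pdivlMr // mul1r ltrD2l ltr_pdivlMr // mul1r.
  by rewrite ltNge; apply/negP => /lmin; rewrite ltnn.
exists (lk + N)%N, (running_max ratio N), Gamma; split.
- exists lk; split; [exact: conj nlk lkmin|by []|].
  set v := fun i => (gamma pa ^+ (lk + i), r (lk + i), running_max ratio i).
  have -> : (gamma pa ^+ lk, feas_step pb x (gamma pa ^+ lk), 0) = v 0.
    by rewrite /v addn0.
  rewrite -[(_, _, _) in X in while_loop _ _ _ X]/(v N).
  apply: while_least => [i' _|].
    by rewrite /v /ratio /r /btr_step addnS exprS.
  split=> [|i']; rewrite /v dq_vE; first by move=> /(_ accN).
  by move=> /contrapT acci'; apply: Nmin.
- exact accN.
- by rewrite running_max_ge0 running_max_lt.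
- exact: Gamma1.
move=> i; case: (ltnP i lk) => [ilk _|lki].
  left; rewrite /Gamma; case: (lk) lkmin ilk => // l lmin il.
  have lth : theta < enorm (r l).
    by rewrite ltNge; apply/negP => /lmin; rewrite ltnn.
  rewrite ltnS in il; apply: (lt_le_trans _ (enorm_btr_step_anti g il)).
  (* [Gamma * theta] is at most the midpoint of [theta] and [enorm (r l)], hence strictly below
     [enorm (r l)]. *)
  rewrite -/(r l); apply: (@le_lt_trans _ _ (2^-1 * (1 + enorm (r l) / theta) * theta)).
    by apply: ler_wpM2r; [exact: ltW|rewrite ge_min lexx orbT].
  by rewrite -mulrA mulrDl divfK ?gt_eqF // mul1r; lra.
(* A ratio rejected in the loop is at most [eps_k], which is below [eps_r], hence strictly below the
   mean of the two. *)
rewrite -{1}(subnKC lki) ltn_add2l => iN; right.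
have := ratioE (i - lk)%N; rewrite subnKC // => ->.
have := running_max_ge ratio iN; have := ratio_lt _ iN.
have := running_max_lt er0 ratio_lt; have := D0 i.
rewrite -mulrN; move: (ratio _) (running_max _ _) (- dotv _ _) => a b d *.
by rewrite ltr_pM2r//; lra.
Qed.

(** Here [theta = 0] and all steps are 0: both tests hold with equality at once, so [lk = 0] and
    Gamma takes its default 2. *)
Lemma cauchy_feas_stationary : F_FEAS pb x = 0 -> con pb x = 0 ->
  cauchy_feas pb pa x theta (FeasOut 1 0 0 2).
Proof.
move=> F0 c0.
have th0 : theta = 0 by rewrite /theta /theta_of F0 enorm0 mulr0.
have g0 : JTc pb x = 0 by rewrite /JTc c0 mul0mx.
have r0 i : feas_step pb x i = 0.
  by have := proj_step_g0 xbox i; rewrite /feas_step g0.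
exists 0%N; split=> //=.
  by split=> //; rewrite r0 enorm0 th0.
rewrite r0; apply: while_exit; apply; split; last by rewrite enorm0 th0.
by rewrite dq_vE model_dec0 dotv0l mulr0 oppr0.
Qed.

Lemma cauchy_feas_exists : (F_FEAS pb x = 0 -> con pb x = 0) ->
  exists fo : feas_out R n,
  [/\ cauchy_feas pb pa x theta fo,
      cond_r pb pa x theta (fo_r fo) (fo_r fo),
      0 <= fo_eps fo < eps_r pa,
      0 < fo_Gamma fo
    & F_FEAS pb x != 0 -> exists ib : nat,
      [/\ fo_r fo = r ib,
          accepts pb pa x (eps_r pa) theta g H ib,
          1 < fo_Gamma fo
        & forall i, (i < ib)%N -> fo_Gamma fo * theta < enorm (r i) \/
            model_dec g H (r i) < - ((fo_eps fo + eps_r pa) / 2 * dotv (r i) g)]].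
Proof.
have /andP[er0 er1] := eps_r01 pa; have /andP[k20 k21] := kappa2_01 pa.
have [F0 /(_ F0) c0|F0 _] := eqVneq (F_FEAS pb x) 0.
  exists (FeasOut 1 0 0 2); split=> /=; first exact: cauchy_feas_stationary.
  - split; rewrite ?dq_vE ?model_dec0 ?mulr0 ?addr0 ?enorm0 //.
    by rewrite mulr_ge0 ?enorm_ge0 // ltW // delta_gt0.
  - by rewrite lexx er0.
  - by [].
  - by [].
have [ib [eps [Gamma [cf acc eps01 G1 before]]]] := cauchy_feas_spec F0.
exists (FeasOut (gamma pa ^+ ib) (r ib) eps Gamma); split=> /=; [exact: cf| |exact: eps01| |].
- have dq0 : 0 <= dq_v pb (r ib) x.
    rewrite dq_vE; apply: le_trans acc.1; rewrite -mulrN mulr_ge0 ?(ltW er0) //.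
    apply/ltW/(proj_step_descent xbox); rewrite ?gamma_expr_gt0 //.
    by rewrite -F_FEASE.
  split; [by rewrite ler_piMl // ltW|by rewrite mulr_ge0 // ltW| |exact: acc.2].
  exact: proj_step_in.
- exact: lt_trans G1.
- by move=> _; exists ib.
Qed.

End Routines.

(** * The penalty parameter *)

Lemma near_lt {R : realType} {T : Type} (F : set_system T) {FF : Filter F}
    (f g : T -> R) (a b : R) : f @ F --> a -> g @ F --> b -> a < b ->
  \forall t \near F, f t < g t.
Proof.
move=> fa gb ab; have fgab : (fun t => f t - g t) @ F --> a - b by exact: cvgB.
have ab0 : a - b < 0 by rewrite subr_lt0.
by near=> t; rewrite -subr_lt0; near: t; exact: (cvgr_lt _ fgab _ ab0).
Unshelve. all: end_near. Qed.

Lemma t_seq_gt0 {R : realType} {n m : nat} (pb : problem R n m) (pa : params R)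
  (ini : initial pb pa) j : 0 < t_seq ini j.
Proof.
elim: j => [|[|j] IH]; [exact: t_init0_gt0|exact: t_init1_gt0|].
rewrite [t_seq _ _]/= -/(t_seq ini j.+1) lt_min powR_gt0 // andbT mulr_gt0 //.
by case/andP: (gamma_t01 pa).
Qed.

Section PenaltyUpdate.
Context {R : realType} {n m : nat} (pb : problem R n m) (pa : params R).
Variables (ini : initial pb pa) (z : state R n m).
Let x := st_x z.
Let y := st_y z.
Hypothesis xbox : in_box pb x.
Hypothesis f_diff : differentiable (obj pb) x.
Hypothesis c_diff : forall a, differentiable (fun u => con pb u 0 a) x.
Hypothesis Nret1 : ~ returns_step1 pb z.
Hypothesis Nret2 : ~ returns_step2 pb z.
Implicit Types (mu : R) (w : al_data R n).

Lemma con_eq0 : F_FEAS pb x = 0 -> con pb x = 0.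
Proof.
move=> F0; apply/eqP; apply: contrapT => /negP c0; apply: Nret2.
by split=> //; rewrite enorm_gt0.
Qed.

(** When [c = 0], [F_AL] is the projected step of length [mu] along [grad_ell]; it vanishes only
    together with [F_L], which Step 1 excludes. *)
Lemma F_AL_neq0 mu : con pb x = 0 -> 0 < mu -> F_AL pb x y mu <> 0.
Proof.
move=> c0 mu0 FAL0; apply: Nret1; rewrite /returns_step1 /F_OPT -/x -/y c0.
suff -> : F_L pb x y = 0 by rewrite oppr0 row_mx0.
move: FAL0; rewrite F_ALE F_LE grad_ALE // /JTc c0 mul0mx addr0 proj_step_scale.
by apply: proj_step_eq0; rewrite ?mul1r.
Qed.

Section VanishingPenalty.
Context {T : Type} {F : set_system T} {FF : Filter F} (mu : T -> R).
Hypothesis mu_to0 : mu @ F --> (0 : R).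

Lemma cvg_grad_AL : mx_cvg F (fun t => grad_AL pb x y (mu t)) (JTc pb x).
Proof.
have -> : JTc pb x = 0 *: grad_ell pb x y + JTc pb x by rewrite scale0r add0r.
under [X in mx_cvg _ X]eq_fun do rewrite grad_ALE //.
by apply: mx_cvgD; [exact: mx_cvgZl|exact: mx_cvg_cst].
Qed.

Lemma cvg_hess_AL :
  mx_cvg F (fun t => mu t *: hess_ell pb x y + gram pb x) (gram pb x).
Proof.
rewrite -[gram pb x in X in mx_cvg _ _ X]add0r -(scale0r (hess_ell pb x y)).
by apply: mx_cvgD; [exact: mx_cvgZl|exact: mx_cvg_cst].
Qed.

Lemma cvg_F_AL : mx_cvg F (fun t => F_AL pb x y (mu t)) (F_FEAS pb x).
Proof.
rewrite F_FEASE; under [X in mx_cvg _ X]eq_fun do rewrite F_ALE.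
apply: mx_cvg_proj_step; exact: cvg_grad_AL.
Qed.

End VanishingPenalty.

Lemma cvg_penalty mu : (fun i => gamma_mu pa ^+ i * mu) @ \oo --> (0 : R).
Proof.
rewrite -[0](mul0r mu); apply: cvgMr_tmp.
have /andP[g0 g1] := gamma_mu01 pa.
by have := @cvg_expr R (gamma_mu pa); apply; rewrite ger0_norm ?ltW.
Qed.

Lemma penalty_gt0 mu i : 0 < mu -> 0 < gamma_mu pa ^+ i * mu.
Proof. by move=> mu0; rewrite mulr_gt0 ?exprn_gt0 //; case/andP: (gamma_mu01 pa). Qed.

Lemma step3_exists : 0 < st_mu z ->
  exists mu, [/\ 0 < mu, step3 pb pa z mu & F_AL pb x y mu <> 0].
Proof.
move=> mu0; pose v i := gamma_mu pa ^+ i * st_mu z.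
have [i imin] : exists i, least_nat (fun i => ~ F_AL pb x y (v i) = 0) i.
  apply: least_nat_exists; apply: contrapT => /forallNP Fall.
  have F0 i : F_AL pb x y (v i) = 0 by apply: contrapT; apply: Fall.
  (* The identically zero sequence of [F_AL] converges to [F_FEAS]. *)
  have FF0 : F_FEAS pb x = 0.
    have cF : mx_cvg \oo (fun i => F_AL pb x y (v i)) (F_FEAS pb x).
      by apply: cvg_F_AL; exact: cvg_penalty.
    apply/matrixP => i j; have := cF i j; under eq_fun do rewrite F0.
    by move/cvg_lim => <- //; rewrite lim_cst.
  exact: F_AL_neq0 (con_eq0 FF0) (penalty_gt0 0 mu0) (F0 0%N).
exists (v i); split; [exact: penalty_gt0| |exact: imin.1].
rewrite /step3; have {1}-> : st_mu z = v 0%N by rewrite /v expr0 mul1r.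
by apply: while_least => // i' _; rewrite /v exprS mulrA.
Qed.

Variable fo : feas_out R n.
Hypothesis eps_lt : 0 <= fo_eps fo < eps_r pa.
Hypothesis Gamma_gt0 : 0 < fo_Gamma fo.
Let e := (fo_eps fo + eps_r pa) / 2.
Let HA mu := mu *: hess_ell pb x y + gram pb x.

(** The last clause keeps the information that the exponent is the first accepted one, needed to
    compare it with that of CauchyFeas. *)
Definition al_cauchy mu w : Prop :=
  [/\ ad_mu w = mu, AL_setup pb pa z fo w, ad_s w = ad_sbar w
    & exists2 i, least_nat (accepts pb pa x e (ad_Theta w)
                              (grad_AL pb x y mu) (HA mu)) i
        & ad_s w = btr_step pb pa x (grad_AL pb x y mu) i].

Let e01 : 0 < e < 1.
Proof. by rewrite /e; have := eps_r01 pa; have := eps_lt; lra. Qed.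

Lemma al_cauchy_exists mu : exists w, al_cauchy mu w.
Proof.
pose Theta := fo_Gamma fo * delta pa * enorm (F_AL pb x y mu).
have [i imin] : exists i,
    least_nat (accepts pb pa x e Theta (grad_AL pb x y mu) (HA mu)) i.
  (* If [F_AL = 0] then [Theta = 0] and the zero step is accepted at once; Step 6 may meet such a
     [mu] before its guard discards it. *)
  apply: least_nat_exists; have [F0|F0] := eqVneq (F_AL pb x y mu) 0.
    exists 0%N; have -> : accepts pb pa x e Theta (grad_AL pb x y mu) (HA mu) 0 =
        (- (e * dotv (F_AL pb x y mu) (grad_AL pb x y mu)) <=
           model_dec (grad_AL pb x y mu) (HA mu) (F_AL pb x y mu) /\
         enorm (F_AL pb x y mu) <= Theta).
      by rewrite /accepts /btr_step expr0 F_ALE.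
    by rewrite /Theta F0 model_dec0 dotv0l enorm0 !mulr0 oppr0.
  have e1 : e < 1 by case/andP: e01.
  have Th0 : 0 < Theta by rewrite !mulr_gt0 ?delta_gt0 // enorm_gt0.
  have acc_near := accepts_near pa xbox (grad_AL pb x y mu) (HA mu) e1 Th0.
  by have [i acci] := filter_ex acc_near; exists i.
pose s := btr_step pb pa x (grad_AL pb x y mu) i.
exists (ALData mu Theta (gamma pa ^+ i) s s); split.
- by [].
- by split; [by []|exact: cauchy_AL_least].
- by [].
- by exists i.
Qed.

Lemma al_cauchy_cond mu w : al_cauchy mu w -> F_AL pb x y mu <> 0 ->
  cond_s pb pa x y w.
Proof.
case=> wmu _ ss [i [[dec nrm] _] si] /eqP F0.
have /andP[e0 e1] := e01; have /andP[k0 k1] := kappa1_01 pa.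
have dq0 : 0 < dq_AL pb (ad_s w) x y (ad_mu w).
  rewrite wmu dq_ALE si; apply: lt_le_trans dec; rewrite -mulrN mulr_gt0 //.
  by apply: (proj_step_descent xbox); rewrite ?gamma_expr_gt0 // -F_ALE.
split; rewrite -?ss.
- by rewrite ler_piMl // ltW.
- exact: mulr_gt0.
- by rewrite si; exact: proj_step_in.
- by rewrite si.
Qed.

Hypothesis before_acceptance : F_FEAS pb x != 0 -> exists ib : nat,
  [/\ fo_r fo = btr_step pb pa x (JTc pb x) ib,
      accepts pb pa x (eps_r pa) (theta_of pb pa x) (JTc pb x) (gram pb x) ib,
      1 < fo_Gamma fo
    & forall i, (i < ib)%N ->
        fo_Gamma fo * theta_of pb pa x < enorm (btr_step pb pa x (JTc pb x) i) \/
        model_dec (JTc pb x) (gram pb x) (btr_step pb pa x (JTc pb x) i) <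
          - (e * dotv (btr_step pb pa x (JTc pb x) i) (JTc pb x))].

Variable W : R -> al_data R n.
Hypothesis WP : forall mu, al_cauchy mu (W mu).

Definition step6_guard w : Prop :=
  ~ cond_infeas ini x (st_j z) (fo_r fo) (ad_s w) \/ F_AL pb x y (ad_mu w) = 0.

(** With [c = 0] the second argument of the minimum is [- (kappa_t t_j)^2 / 2], while the reduction
    of [q_v] is at least [- K / 2] times the squared step norm, which tends to 0 with [grad_AL]. *)
Lemma step6_stops_feasible (mu : nat -> R) : (forall i, 0 < mu i) ->
  mu @ \oo --> (0 : R) -> F_FEAS pb x = 0 ->
  \forall i \near \oo, ~ step6_guard (W (mu i)).
Proof.
move=> mu_gt0 mu0 F0; have c0 := con_eq0 F0.
have g0 : JTc pb x = 0 by rewrite /JTc c0 mul0mx.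
have [K K0 HK] := quad_form_le (gram pb x).
pose h i := grad_AL pb x y (mu i).
have tol0 : 0 < (kappa_t pa * t_seq ini (st_j z)) ^+ 2.
  by rewrite exprn_gt0 // mulr_gt0 ?t_seq_gt0 //; case/andP: (kappa_t01 pa).
have hto0 : (fun i => K * dotv (h i) (h i)) @ \oo --> (0 : R).
  rewrite -[0](mulr0 K) -[X in _ * X](dotv0l (JTc pb x)) -{1}g0.
  by apply: cvgMl_tmp; apply: cvg_dotv; apply: cvg_grad_AL.
near=> i.
have hi : K * dotv (h i) (h i) < (kappa_t pa * t_seq ini (st_j z)) ^+ 2.
  by near: i; exact: (cvgr_lt _ hto0 _ tol0).
have [wmu _ _ [i' _ si']] := WP (mu i); case; last first.
  by rewrite wmu; exact: F_AL_neq0.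
apply; rewrite /cond_infeas ge_min; apply/orP; right.
rewrite dq_vE g0 /model_dec [dotv _ 0]dotvC dotv0l oppr0 add0r /viol c0 enorm0.
(* The accepted power of [gamma] varies with [mu] but never exceeds 1, so the step is bounded by
   [grad_AL] uniformly. *)
have ssle : K * dotv (ad_s (W (mu i))) (ad_s (W (mu i))) <= K * dotv (h i) (h i).
  apply: (ler_wpM2l K0); rewrite si'.
  have q0 := gamma_expr_gt0 pa i'; have q1 := gamma_expr_le1 pa i'.
  apply: le_trans (proj_step_dot_le xbox (h i) (ltW q0)) _.
  rewrite -[leRHS]mul1r; apply: ler_wpM2r; first exact: dotv_ge0.
  by rewrite expr_le1 // ltW.
rewrite expr0n /= mulr0 add0r lerN2 ge_max; apply/andP; split; last first.
  by rewrite mulr_ge0 ?invr_ge0 ?(ltW tol0).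
rewrite ler_pM2l ?invr_gt0 //.
exact: le_trans (HK _) (le_trans ssle (ltW hi)).
Unshelve. all: end_near. Qed.

(* For small mu the tests of CauchyAL have the same outcomes as those of
   CauchyFeas, so both routines stop at the same power of gamma. *)
Lemma step6_stops_infeasible (mu : nat -> R) :
  mu @ \oo --> (0 : R) -> F_FEAS pb x != 0 ->
  \forall i \near \oo, ~ step6_guard (W (mu i)).
Proof.
move=> mu0 F0; have [ib [rE [dec nrm] G1 before]] := before_acceptance F0.
pose g := JTc pb x; pose H := gram pb x; pose r i := btr_step pb pa x g i.
pose h k := grad_AL pb x y (mu k); pose s k i := btr_step pb pa x (h k) i.
pose Th k := fo_Gamma fo * delta pa * enorm (F_AL pb x y (mu k)).
have hg : mx_cvg \oo h g by exact: cvg_grad_AL.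
have HH : mx_cvg \oo (fun k => HA (mu k)) H by exact: cvg_hess_AL.
have sr i : mx_cvg \oo (s ^~ i) (r i) by exact: mx_cvg_proj_step.
have FF : mx_cvg \oo (fun k => F_AL pb x y (mu k)) (F_FEAS pb x) by exact: cvg_F_AL.
have ThT : Th @ \oo --> fo_Gamma fo * theta_of pb pa x.
  by rewrite /theta_of mulrA; apply: cvgMl_tmp; exact: cvg_enorm.
have decT i : (fun k => model_dec (h k) (HA (mu k)) (s k i)) @ \oo --> model_dec g H (r i).
  exact: cvg_model_dec.
have dotT i : (fun k => - (e * dotv (s k i) (h k))) @ \oo --> - (e * dotv (r i) g).
  by apply: cvgN; apply: cvgMl_tmp; exact: cvg_dotv.
have nrmT i : (fun k => enorm (s k i)) @ \oo --> enorm (r i) by exact: cvg_enorm.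
have th0 : 0 < theta_of pb pa x by rewrite mulr_gt0 ?delta_gt0 ?enorm_gt0.
have D0 : 0 < - dotv (r ib) g.
  by apply: (proj_step_descent xbox); rewrite ?gamma_expr_gt0 // -F_FEASE.
have [/andP[er0 er1] /andP[k30 k31]] := (eps_r01 pa, kappa3_01 pa).
have dq0 : 0 < model_dec g H (r ib).
  by apply: lt_le_trans dec; rewrite -mulrN mulr_gt0.
(* In the limit both inequalities at [ib] are strict: [e < eps_r] relaxes the decrease test and
   [1 < fo_Gamma fo] enlarges the radius. *)
have acc_near : \forall k \near \oo, accepts pb pa x e (Th k) (h k) (HA (mu k)) ib.
  have A : \forall k \near \oo, - (e * dotv (s k ib) (h k)) < model_dec (h k) (HA (mu k)) (s k ib).
    apply: near_lt (dotT ib) (decT ib) _; apply: lt_le_trans dec.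
    by rewrite -!mulrN ltr_pM2r // /e; have := eps_lt; lra.
  have B : \forall k \near \oo, enorm (s k ib) < Th k.
    apply: near_lt (nrmT ib) ThT _; apply: le_lt_trans nrm _.
    by rewrite -[ltLHS]mul1r ltr_pM2r.
  by near=> k; split; apply: ltW; near: k.
(* Only finitely many exponents precede [ib], so their strict rejections persist simultaneously. *)
have rej_near : \forall k \near \oo, forall i : 'I_ib,
    ~ accepts pb pa x e (Th k) (h k) (HA (mu k)) i.
  apply: filter_forall => i; have [ri|ri] := before i (ltn_ord i).
    have A : \forall k \near \oo, Th k < enorm (s k i) by exact: near_lt ThT (nrmT i) ri.
    near=> k; case=> _; rewrite leNgt => /negP; apply.
    by near: k.
  have A : \forall k \near \oo, model_dec (h k) (HA (mu k)) (s k i) < - (e * dotv (s k i) (h k)).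
    exact: near_lt (decT i) (dotT i) ri.
  near=> k; case=> + _; rewrite leNgt => /negP; apply.
  by near: k.
(* The limit reduction is positive and [kappa3 < 1], which leaves room for (C). *)
have dqv_near : \forall k \near \oo,
    kappa3 pa * model_dec g H (r ib) < model_dec g H (s k ib).
  apply: (@near_lt _ _ _ _ _ _ (kappa3 pa * model_dec g H (r ib)) (model_dec g H (r ib))).
  - exact: cvg_cst.
  - by apply: cvg_model_dec; [exact: mx_cvg_cst|exact: mx_cvg_cst|exact: sr].
  - by rewrite gtr_pMl.
have F_near : \forall k \near \oo, 0 < enorm (F_AL pb x y (mu k)).
  apply: (near_lt _ (cvg_enorm FF)); first exact: cvg_cst.
  by rewrite enorm_gt0.
near=> k.
have [wmu [ThE _] _ [i [acci imin] si]] := WP (mu k).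
rewrite wmu -/x -/y -/(Th k) in ThE; rewrite ThE -/(h k) in acci imin.
have iE : i = ib.
  apply/eqP; rewrite eqn_leq imin ?andTb; last by near: k.
  rewrite leqNgt; apply/negP => i_ib.
  have : ~ accepts pb pa x e (Th k) (h k) (HA (mu k)) (Ordinal i_ib).
    by move: (Ordinal i_ib); near: k.
  exact.
case; last first.
  rewrite wmu; apply/eqP; rewrite -enorm_gt0; by near: k.
apply; rewrite /cond_infeas ge_min; apply/orP; left.
rewrite !dq_vE si iE rE; apply: ltW; by near: k.
Unshelve. all: end_near. Qed.

(** The choice [W] of Cauchy data for each [mu] gives Step 6 a single trajectory along
    [gamma_mu ^+ i * mu], and the guard fails eventually on it. *)
Lemma step6_exists mu : 0 < mu -> F_AL pb x y mu <> 0 ->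
  exists mu', [/\ 0 < mu', step6 ini cauchy_step z fo (fo_r fo) (W mu) (W mu')
    & ~ step6_guard (W mu')].
Proof.
move=> mu0 F0; pose v i := gamma_mu pa ^+ i * mu.
have v0 i : 0 < v i by exact: penalty_gt0.
have [k kmin] : exists k, least_nat (fun k => ~ step6_guard (W (v k))) k.
  apply: least_nat_exists.
  have := cvg_penalty mu; rewrite -/v => vto0.
  have stops : \forall k \near \oo, ~ step6_guard (W (v k)).
    have [FF|FF] := eqVneq (F_FEAS pb x) 0.
      exact: step6_stops_feasible.
    exact: step6_stops_infeasible.
  by have [k kP] := filter_ex stops; exists k.
exists (v k); split; [exact: v0| |exact: kmin.1].
rewrite /step6; have {1}-> : mu = v 0%N by rewrite /v expr0 mul1r.
apply: (@while_least _ _ _ (W \o v)) kmin => i _ /=.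
have [wmu _ _ _] := WP (v i); have [wmu' su ss _] := WP (v i.+1).
split; [by rewrite wmu wmu' /v exprS mulrA|exact: su|exact: ss|].
rewrite wmu'; have [FA|FA] := eqVneq (F_AL pb x y (v i.+1)) 0.
  by right; split; [exact: FA|exact: ss].
by left; apply: al_cauchy_cond (WP _) _; apply/eqP.
Qed.

End PenaltyUpdate.

(** * Line search, multiplier update and invariants *)

(** The difference quotients along the nonzero lengths [q ^+ i] tend to the directional derivative,
    which lies strictly below [d]. *)
Lemma line_search_exists {R : realType} {n : nat} (h : 'rV[R]_n -> R)
    (x s : 'rV[R]_n) (q d : R) : 0 < q < 1 -> differentiable h x ->
  'D_s h x < d -> exists i, h (x + q ^+ i *: s) <= h x + q ^+ i * d.
Proof.
move=> q01 dh hd; have /andP[q0 q1] := q01.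
have quot : (fun a => a^-1 *: ((h \o shift x) (a *: s) - h x)) @ 0^' --> 'D_s h x.
  exact: diff_derivable.
have lt_near : \forall a \near (0 : R), a != 0 ->
    a^-1 *: ((h \o shift x) (a *: s) - h x) < d.
  exact: (cvgr_lt _ quot _ hd).
have q_to0 : (fun i => q ^+ i) @ \oo --> (0 : R).
  by have := @cvg_expr R q; apply; rewrite ger0_norm ?ltW.
have lt_seq : \forall i \near \oo, q ^+ i != 0 ->
    (q ^+ i)^-1 *: ((h \o shift x) (q ^+ i *: s) - h x) < d.
  exact: q_to0 _ lt_near.
have [i lti] := filter_ex lt_seq; exists i.
have qi0 : 0 < q ^+ i by rewrite exprn_gt0.
have := lti (lt0r_neq0 qi0); rewrite /= /GRing.scale /= [_ *: s + x]addrC.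
by rewrite mulrC ltr_pdivrMr // mulrC => /ltW; rewrite lerBlDl.
Qed.

(** The slope is at most [- dq], the quadratic part of the model being nonnegative, and [eta_s < 1]
    makes it strictly less than [- (eta_s * dq)]. *)
Lemma step7_exists {R : realType} {n m : nat} (pb : problem R n m) (pa : params R)
    (z : state R n m) (w : al_data R n) :
  differentiable (obj pb) (st_x z) ->
  (forall a, differentiable (fun u => con pb u 0 a) (st_x z)) ->
  0 < dq_AL pb (ad_s w) (st_x z) (st_y z) (ad_mu w) ->
  exists x', step7 pb pa z w x'.
Proof.
move=> fd cd; set dq := dq_AL _ _ _ _ _ => dq0.
have /andP[e0 e1] := eta_s01 pa.
have slope : 'D_(ad_s w) (fun u => AL pb u (st_y z) (ad_mu w)) (st_x z) < - (eta_s pa * dq).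
  rewrite derive_AL // ltrNr.
  have : dq <= - dotv (ad_s w) (grad_AL pb (st_x z) (st_y z) (ad_mu w)).
    by rewrite /dq dq_ALE /model_dec gerBl le_max lexx orbT.
  by apply: lt_le_trans; rewrite gtr_pMl.
have [i iP] := line_search_exists (gamma_alpha01 pa) (differentiable_AL fd cd _ _) slope.
pose Q i := AL pb (st_x z + gamma_alpha pa ^+ i *: ad_s w) (st_y z) (ad_mu w)
  <= AL pb (st_x z) (st_y z) (ad_mu w) - eta_s pa * gamma_alpha pa ^+ i * dq.
have [|i0 i0P] := @least_nat_exists Q.
  by exists i; rewrite /Q; move: iP; rewrite mulrN mulrCA mulrA.
by exists (st_x z + gamma_alpha pa ^+ i0 *: ad_s w); exists i0.
Qed.

(** The admissible set contains 0 because [enorm y <= Y]. Its supremum is admissible: otherwise, by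
    continuity, the norm would exceed [Y] on a whole neighbourhood, which must meet the set. *)
Lemma is_alpha_y_exists {R : realType} {m : nat} (y yhat : 'rV[R]_m) (Y : R) :
  enorm y <= Y -> exists a, is_alpha_y y yhat Y a.
Proof.
move=> yY; pose phi (b : R) := enorm ((1 - b) *: y + b *: yhat).
pose A := [set b : R | 0 <= b <= 1 /\ phi b <= Y].
have A0 : A 0 by rewrite /A /= /phi lexx ler01 subr0 scale1r scale0r addr0.
have Aub : ubound A 1 by move=> b [/andP[]].
have supA : has_sup A by split; [exists 0|exists 1].
have le_sup b : A b -> b <= sup A by move=> Ab; exact: sup_upper_bound.
exists (sup A); split=> [|b Ab]; last exact: le_sup.
split; first by rewrite le_sup // ge_sup //; exists 0.
rewrite leNgt; apply/negP => Ylt.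
have phi_cvg : phi b @[b --> sup A] --> phi (sup A).
  apply: cvg_enorm; apply: mx_cvgD; apply: mx_cvgZl; last exact: cvg_id.
  by apply: cvgB; [exact: cvg_cst|exact: cvg_id].
have gt_near : \forall b \near sup A, Y < phi b by exact: (cvgr_gt _ phi_cvg _ Ylt).
have [r /= r0 rP] := (nbhs_ballP _ _).1 gt_near.
have [b Ab rb] := sup_adherent r0 supA.
have := rP b; rewrite /ball /= ger0_norm ?subr_ge0 ?le_sup //.
by rewrite ltrBlDr -ltrBlDl => /(_ rb); rewrite ltNge Ab.2.
Qed.

(** * Invariants of the iterates and computability of the updates *)

Section Invariants.
Context {R : realType} {n m : nat} (pb : problem R n m) (pa : params R).
Variable ini : initial pb pa.
Hypothesis Y_mono : forall j : nat, (1 <= j)%N -> Y_seq ini j <= Y_seq ini j.+1.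
Implicit Types (z : state R n m) (w : al_data R n).

Lemma in_box_segment x s a : in_box pb x -> in_box pb (x + s) -> 0 <= a <= 1 ->
  in_box pb (x + a *: s).
Proof.
move=> xb xsb /andP[a0 a1] i; have := xb i; have := xsb i; rewrite !mxE.
by move=> /andP[? ?] /andP[? ?]; apply/andP; split; nra.
Qed.

Definition state_inv z : Prop :=
  [/\ in_box pb (st_x z), 0 < st_mu z, (1 <= st_j z)%N
    & enorm (st_y z) <= Y_seq ini (st_j z)].

Lemma state_inv_init : state_inv (init_state ini).
Proof. by split; [exact: x_init_box|exact: mu_init_gt0| |exact: y_init_le]. Qed.

Lemma step3_gt0 z mu : step3 pb pa z mu -> 0 < st_mu z -> 0 < mu.
Proof.
move=> st3 mu0.
suff step mu1 mu2 : F_AL pb (st_x z) (st_y z) mu1 = 0 -> 0 < mu1 ->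
    mu2 = gamma_mu pa * mu1 -> 0 < mu2 by have [] := while_inv step st3 mu0.
by move=> _ mu10 ->; rewrite mulr_gt0 //; case/andP: (gamma_mu01 pa).
Qed.

(** The loop invariant allows [F_AL = 0] in place of (A); on exit the guard rules that alternative
    out. *)
Lemma step6_inv sel z fo r w w' : step6 ini sel z fo r w w' ->
  0 < ad_mu w -> cond_s pb pa (st_x z) (st_y z) w ->
  0 < ad_mu w' /\ cond_s pb pa (st_x z) (st_y z) w'.
Proof.
move=> st6 mu0 cw.
pose P v := 0 < ad_mu v /\
  (cond_s pb pa (st_x z) (st_y z) v \/ F_AL pb (st_x z) (st_y z) (ad_mu v) = 0).
have Pw : P w by split; [|left].
have [] := while_inv (P := P) _ st6 Pw.
  move=> v v' _ [v0 _] [muv' _ _ cv']; split.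
    by rewrite muv' mulr_gt0 //; case/andP: (gamma_mu01 pa).
  by case: cv' => [cv'|[F0 _]]; [left|right].
by case=> mu0' [cw' //|F0] Ng; case: Ng; right.
Qed.

(** The box is convex and the step length lies in [[0, 1]]; the multiplier bound is part of the
    choice of [alpha_y], or is unchanged. *)
Lemma iteration_inv z z' : iteration ini z z' -> state_inv z -> state_inv z'.
Proof.
move=> [_ _ [fo [r [w [[w5 [st3 _ _ [_ cs5] st6]] [st7 [[yhat _ st8] muz']]]]]]].
move=> [xb mu0 j1 yY].
have [muw [_ _ xsb _]] := step6_inv st6 (step3_gt0 st3 mu0) cs5.
have box' : in_box pb (st_x z').
  have /andP[a0 a1] := gamma_alpha01 pa.
  case: st7 => i _ ->; apply: in_box_segment => //.
  by rewrite exprn_ge0 ?exprn_ile1 // ltW.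
split; [exact: box'|by rewrite muz'| |].
  by case: st8 => [[_ [a _ [_ ->]]]|[_ [_ ->]]].
case: st8 => [[_ [a [[_ ya] _] [-> ->]]]|[_ [-> ->]]]; first exact: ya.
exact: yY.
Qed.

Lemma step6_sub sel sel' z fo r w w' : (forall u v, sel u v -> sel' u v) ->
  step6 ini sel z fo r w w' -> step6 ini sel' z fo r w w'.
Proof.
by move=> ss'; apply: while_sub => v v' [? ? ? ?]; split=> //; exact: ss'.
Qed.

Lemma steps3_6_any z fo r w :
  steps3_6 ini cauchy_step z fo r w -> steps3_6 ini any_step z fo r w.
Proof.
case=> w5 [st3 cf [_ cr] [_ cs] st6]; exists w5; split; [exact: st3|exact: cf| | |].
- by split.
- by split.
- exact: step6_sub st6.
Qed.

(** [Y_mono] carries the bound on [y] over to the next [Y], so that [alpha_y] exists. *)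
Lemma step8_exists z x' mu yhat : state_inv z ->
  exists y' j', step8 ini x' (st_y z) mu (st_j z) yhat y' j'.
Proof.
case=> _ _ j1 yY.
have [test|Ntest] := pselect (enorm (con pb x') <= t_seq ini (st_j z) /\
    Num.min (enorm (F_L pb x' yhat)) (enorm (F_AL pb x' (st_y z) mu))
      <= T_seq ini (st_j z)); last first.
  by exists (st_y z), (st_j z); right.
have [a aP] := is_alpha_y_exists yhat (le_trans yY (Y_mono j1)).
by exists ((1 - a) *: st_y z + a *: yhat), (st_j z).+1; left; split=> //; exists a.
Qed.

(** The better of the two reference multipliers attains the minimum. *)
Lemma yhat_ok_exists x' y mu : exists yhat, yhat_ok pb x' y mu yhat.
Proof.
pose p := pi_mult pb x' y mu.
have /orP[le_yp|le_py] := le_total (enorm (F_L pb x' y)) (enorm (F_L pb x' p)).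
  by exists y; rewrite /yhat_ok (min_l le_yp) lexx.
by exists p; rewrite /yhat_ok (min_r le_py) lexx.
Qed.

End Invariants.

(** * Well-posedness of one iteration *)

Lemma C2_at_differentiable {R : realType} {n : nat} (h : 'rV[R]_n -> R) x :
  C2_at h x -> differentiable h x.
Proof. by move/nbhs_singleton => []. Qed.

Theorem theorem2p2 (R : realType) (n m : nat) (pb : problem R n m)
    (pa : params R) (ini : initial pb pa)
    (Y_mono : forall j : nat, (1 <= j)%N -> Y_seq ini j <= Y_seq ini j.+1)
    (k : nat) (z : nat -> state R n m)
    (z_init : z 0%N = init_state ini)
    (z_iter : forall i : nat, (i < k)%N -> iteration ini (z i) (z i.+1))
    (f_C2 : forall i : nat, (i <= k)%N -> C2_at (obj pb) (st_x (z i)))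
    (c_C2 : forall i : nat, (i <= k)%N ->
       forall a : 'I_m, C2_at (fun x => con pb x 0 a) (st_x (z i))) :
  let x := st_x (z k) in
  let y := st_y (z k) in
  let j := st_j (z k) in
  [\/ returns_step1 pb (z k) /\ first_order_stationary pb x y,
      returns_step2 pb (z k) /\ infeasible_stationary pb x
    | exists (fo : feas_out R n) (r : 'rV[R]_n) (w : al_data R n),
      [/\ (* the algorithm computes mu_k, with the Cauchy steps as r_k, s_k *)
          [/\ ~ returns_step1 pb (z k), ~ returns_step2 pb (z k)
            & steps3_6 ini cauchy_step (z k) fo r w],
          0 < ad_mu w /\ F_AL pb x y (ad_mu w) <> 0,
          r = fo_r fo /\ ad_s w = ad_sbar w,
          [/\ cond_s pb pa x y w,
              cond_r pb pa x (theta_of pb pa x) (fo_r fo) r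
            & cond_infeas ini x j r (ad_s w)]
        & (* the next iterate is computed, whichever yhat is chosen *)
          exists x' : 'rV[R]_n,
          [/\ step7 pb pa (z k) w x',
              exists yhat : 'rV[R]_m, yhat_ok pb x' y (ad_mu w) yhat
            & forall yhat : 'rV[R]_m,
                (enorm (con pb x') <= t_seq ini j ->
                   yhat_ok pb x' y (ad_mu w) yhat) ->
                exists (y' : 'rV[R]_m) (j' : nat),
                  step8 ini x' y (ad_mu w) j yhat y' j' /\
                  iteration ini (z k) (State x' y' (ad_mu w) j')]]].
Proof.
move=> x y j.
have inv i : (i <= k)%N -> state_inv ini (z i).
  elim: i => [_|i IH ik]; first by rewrite z_init; exact: state_inv_init.
  exact: iteration_inv (z_iter i ik) (IH (ltnW ik)).
have invk := inv k (leqnn k); have [xbox mu0 _ _] := invk.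
have fd := C2_at_differentiable (f_C2 k (leqnn k)).
have cd a := C2_at_differentiable (c_C2 k (leqnn k) a).
have [ret1|Nret1] := pselect (returns_step1 pb (z k)); first by constructor 1.
have [ret2|Nret2] := pselect (returns_step2 pb (z k)).
  constructor 2; split=> //; case: ret2 => _ [c0 F0]; split=> //.
  by rewrite /viol mulr_gt0 ?invr_gt0 ?exprn_gt0.
constructor 3.
have [fo [cf cr eps_lt G0 before]] :=
  cauchy_feas_exists pa xbox (con_eq0 Nret1 Nret2).
have [mu3 [mu30 st3 F3]] := step3_exists pa xbox fd cd Nret1 Nret2 mu0.
have [W WP] := choice (al_cauchy_exists (z := z k) xbox eps_lt G0).
have [mu [muk0 st6 Ng]] :=
  step6_exists ini xbox fd cd Nret1 Nret2 eps_lt before WP mu30 F3.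
have [w5mu su5 ss5 _] := WP mu3; have [wmu su ss _] := WP mu.
have cs5 := al_cauchy_cond xbox eps_lt (WP mu3) F3.
have FAL : F_AL pb x y mu <> 0 by move=> F0; apply: Ng; right; rewrite wmu.
have cs := al_cauchy_cond xbox eps_lt (WP mu) FAL.
have st36 : steps3_6 ini cauchy_step (z k) fo (fo_r fo) (W mu).
  exists (W mu3); split; [by rewrite w5mu|exact: conj cf su5|exact: conj cr|
    exact: conj ss5 cs5|exact: st6].
have dq0 : 0 < dq_AL pb (ad_s (W mu)) x y (ad_mu (W mu)).
  case: cs => _ + _ _; rewrite -ss pmulr_rgt0 //.
  by case/andP: (kappa1_01 pa).
have [x' st7] := step7_exists pa fd cd dq0.
exists fo, (fo_r fo), (W mu); split.
- by split.
- by rewrite wmu.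
- by split.
- by split; [exact: cs|exact: cr|apply: contrapT => NC; apply: Ng; left].
exists x'; split; [exact: st7|exact: yhat_ok_exists|].
move=> yhat yhatP.
have [y' [j' st8]] := step8_exists Y_mono x' (ad_mu (W mu)) yhat invk.
(* The same Cauchy run and the given [yhat] witness a full iteration. *)
exists y', j'; split; first exact: st8.
split=> //; exists fo, (fo_r fo), (W mu).
split; first exact: steps3_6_any.
by split; [exact: st7|split; [exists yhat|]].
Qed.
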